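(* Let $\mathbf{b}\in\mathbb{R}^{\mathcal{O}_{d+1}}$ (with $b_{[d+1]}$ arbitrary) satisfy: (1) (Local submodularity) for every $\pi\in\mathfrak{S}_{d+1}$ and all $\mathcal{S},\mathcal{T}$ in the interval $[\mathcal{T}(\pi),\hat 1]$ of $\mathcal{O}_{d+1}$, $b_{\mathcal{S}\vee\mathcal{T}}+b_{\mathcal{S}\wedge\mathcal{T}}\le b_{\mathcal{S}}+b_{\mathcal{T}}$ (where $b_{\hat 1}=b_{[d+1]}$); (2) (Essential inequalities) for every rank-$1$ element $\mathcal{T}=s_1|\cdots|s_{i-1}|s_is_i'|s_{i+1}|\cdots|s_d$ of $\mathcal{O}_{d+1}$, with $\mathcal{T}_0=s_1|\cdots|s_{i-1}|s_i|s_i'|s_{i+1}|\cdots|s_d$, $\mathcal{T}_0'=s_1|\cdots|s_{i-1}|s_i'|s_i|s_{i+1}|\cdots|s_d$ and $\mathcal{S}=s_1\cdots s_{i-1}|s_is_i'|s_{i+1}\cdots s_d$ (empty blocks omitted), $2b_{\mathcal{T}}+b_{\mathcal{S}}\le b_{\mathcal{T}_0}+b_{\mathcal{T}_0'}+b_{[d+1]}$, the term $b_{[d+1]}$ being omitted when $i=1$. Then the linear system $\langle\mathbf{1},\mathbf{x}\rangle=b_{[d+1]}$, $\langle\mathbf{e}_{\mathcal{T}},\mathbf{x}\rangle\le b_{\mathcal{T}}$ for all $\mathcal{T}\in\overline{\mathcal{O}_{d+1}}$ defines a generalized nested permutohedron in $\mathbb{R}^{d+1}$, and every generalized nested permutohedron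 arises in this way from a unique such $\mathbf{b}$. Furthermore, if a polytope $P\subset\mathbb{R}^{d+1}$ is defined by this system and the representation is tight, then $P$ is a generalized nested permutohedron if and only if $\mathbf{b}$ satisfies conditions (1) and (2).
   Context: $\mathcal{O}_{d+1}$ is the poset of ordered set partitions $S_1|\cdots|S_k$ of $[d+1]$ (nonempty disjoint blocks covering $[d+1]$) ordered by refinement ($\mathcal{S}\le\mathcal{T}$ iff $\mathcal{T}$ is obtained from $\mathcal{S}$ by merging consecutive blocks), ranked by $(d+1)-\#\text{blocks}$, with maximum $\hat 1=([d+1])$; $\overline{\mathcal{O}_{d+1}}=\mathcal{O}_{d+1}\setminus\{\hat1\}$; $\mathcal{T}(\pi)=\{\pi^{-1}(1)\}|\cdots|\{\pi^{-1}(d+1)\}$ for $\pi\in\mathfrak{S}_{d+1}$; each interval $[\mathcal{T}(\pi),\hat 1]$ is a Boolean lattice. $\mathbf{e}_{\mathcal{T}}=\sum_i i\sum_{j\in S_i}\mathbf{e}_j$ for $\mathcal{T}=S_1|\cdots|S_k$; $\mathbf{1}$ is the all-one vector. $W_d=\mathbb{R}^{d+1}/\mathbb{R}\mathbf{1}$, and the nested Braid fan $\mathrm{Br}_d^2$ in $W_d$ consists of the cones $\sigma(\pi,\tau)=\{\mathbf{x}: x_{\pi^{-1}(1)}\le\cdots\le x_{\pi^{-1}(d+1)},\ (\Delta\mathbf{x})^\pi_{\tau^{-1}(1)}\le\cdots\le(\Delta\mathbf{x})^\pi_{\tau^{-1}(d)}\}$, $(\pi,\tau)\in\mathfrak{S}_{d+1}\times\mathfrak{S}_d$,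 $(\Delta\mathbf{x})^\pi_i=x_{\pi^{-1}(i+1)}-x_{\pi^{-1}(i)}$, and their faces. A generalized nested permutohedron is a polytope lying in an affine hyperplane $\{\sum x_i=c\}$ whose normal fan (in $W_d$, normal cone of face $F$ of $P$ being $\{\mathbf{w}:\langle\mathbf{w},\mathbf{x}\rangle\ge\langle\mathbf{w},\mathbf{y}\rangle\ \forall\mathbf{x}\in F,\mathbf{y}\in P\}$) is a coarsening of $\mathrm{Br}_d^2$, i.e. every cone of it is a union of cones of $\mathrm{Br}_d^2$. A system of inequalities defining $P$ is a tight representation if each inequality holds with equality at some point of $P$. *)

(* Defs.v *)
From mathcomp Require Import all_boot all_order all_algebra all_fingroup.
Set Implicit Arguments.
Unset Strict Implicit.
Unset Printing Implicit Defensive.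
Import Order.TTheory GRing.Theory Num.Theory.

(* The ground set [d+1] is 'I_d.+1 (numbered from 0), and S_1|...|S_k is the
   sequence [:: S_1; ...; S_k]. *)
Definition is_osp (d : nat) (s : seq {set 'I_d.+1}) : bool :=
  uniq s && partition [set B in s] [set: 'I_d.+1].

Definition osp (d : nat) := {s : seq {set 'I_d.+1} | is_osp s}.

(* The consecutive blocks of S are grouped into runs, and each run is merged
   into its union; an empty run would give an empty block, which T lacks. *)
Definition osp_le (d : nat) (S T : osp d) : Prop :=
  exists2 runs : seq (seq {set 'I_d.+1}),
    flatten runs = val S & [seq \bigcup_(B <- r) B | r <- runs] = val T.

Definition osp_rank (d : nat) (T : osp d) : nat := d.+1 - size (val T).

Lemma osp_top_subproof (d : nat) : is_osp [:: [set: 'I_d.+1]].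
Proof.
have -> : is_osp [:: [set: 'I_d.+1]] = partition [set [set: 'I_d.+1]] setT.
  by rewrite /is_osp /=; congr partition; apply/setP=> B; rewrite !inE.
rewrite /partition /cover big_set1 eqxx trivIset1 inE.
by apply/eqP => /setP /(_ ord0); rewrite !inE.
Qed.

Definition osp_top (d : nat) : osp d := exist (fun s => is_osp s) _ (osp_top_subproof d).

Definition singletons (d : nat) (p : seq 'I_d.+1) : seq {set 'I_d.+1} :=
  [seq [set i] | i <- p].

Lemma osp_perm_subproof (d : nat) (pi : 'S_d.+1) :
  is_osp (singletons [seq (pi^-1)%g i | i <- enum 'I_d.+1]).
Proof.
rewrite /is_osp /singletons map_inj_uniq; last exact: set1_inj.
rewrite map_inj_uniq ?enum_uniq /=; last exact: perm_inj.
set P := [set B in _].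
have -> : P = [set [set i] | i : 'I_d.+1].
  apply/setP=> B; rewrite inE; apply/mapP/imsetP => [[i _ ->]|[i _ ->]].
    by exists i.
  exists i => //; apply/mapP; exists (pi i); first by rewrite mem_enum.
  by rewrite permK.
apply/and3P; split.
- apply/eqP/setP=> i; rewrite [RHS]inE; apply/bigcupP.
  by exists [set i]; rewrite ?inE //; apply: imset_f.
- apply/trivIsetP=> _ _ /imsetP[i _ ->] /imsetP[j _ ->] neq.
  by rewrite disjoints1 inE; apply: contraNneq neq => ->.
- by apply/imsetP=> -[i _] /setP /(_ i); rewrite !inE eqxx.
Qed.

(* T(pi) = {pi^-1(1)} | ... | {pi^-1(d+1)} *)
Definition osp_perm (d : nat) (pi : 'S_d.+1) : osp d :=
  exist (fun s => is_osp s) _ (osp_perm_subproof pi).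

Definition in_interval (d : nat) (pi : 'S_d.+1) (S : osp d) : Prop :=
  osp_le (osp_perm pi) S /\ osp_le S (osp_top d).

(* J is the join, resp. M the meet, of S and T in [T(pi), top]; these exist
   and are unique when S and T lie in the interval, which is Boolean. *)
Definition is_join (d : nat) (pi : 'S_d.+1) (S T J : osp d) : Prop :=
  [/\ in_interval pi J, osp_le S J, osp_le T J
    & forall U, in_interval pi U -> osp_le S U -> osp_le T U -> osp_le J U].

Definition is_meet (d : nat) (pi : 'S_d.+1) (S T M : osp d) : Prop :=
  [/\ in_interval pi M, osp_le M S, osp_le M T
    & forall U, in_interval pi U -> osp_le U S -> osp_le U T -> osp_le U M].

Local Open Scope ring_scope.

Definition locally_submodular (R : numDomainType) (d : nat)
    (b : osp d -> R) : Prop :=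
  forall (pi : 'S_d.+1) (S T J M : osp d),
    in_interval pi S -> in_interval pi T ->
    is_join pi S T J -> is_meet pi S T M ->
    b J + b M <= b S + b T.

(* p lists s_1, ..., s_(i-1) and q lists s_(i+1), ..., s_d, so that i = 1
   exactly when p is empty. *)
Definition essential_inequalities (R : numDomainType) (d : nat)
    (b : osp d -> R) : Prop :=
  forall (T T0 T0' S : osp d) (p q : seq 'I_d.+1) (s s' : 'I_d.+1),
    osp_rank T = 1%N -> s != s' ->
    val T = singletons p ++ [set s; s'] :: singletons q ->
    val T0 = singletons p ++ [set s] :: [set s'] :: singletons q ->
    val T0' = singletons p ++ [set s'] :: [set s] :: singletons q ->
    val S = [seq B <- [:: [set x in p]; [set s; s']; [set x in q]]
            | B != set0] ->
    2 * b T + b S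
      <= b T0 + b T0' + (if p is [::] then 0 else b (osp_top d)).

(* e_T = sum_i i * sum_(j in S_i) e_j; blocks are weighted from 1, whereas
   sequence positions start from 0. *)
Definition e_osp (R : numDomainType) (d : nat) (T : osp d) : 'rV[R]_d.+1 :=
  \sum_(i < size (val T))
    i.+1%:R *: \sum_(j in nth set0 (val T) i) delta_mx 0 j.

From mathcomp Require Import all_classical all_reals.
From mathcomp Require Import topology normedtype.
Import numFieldNormedType.Exports.
Local Open Scope classical_set_scope.

Definition dot (R : realType) (n : nat) (u v : 'rV[R]_n) : R :=
  \sum_(i < n) u 0 i * v 0 i.

Definition is_polyhedron (R : realType) (n : nat) (P : set 'rV[R]_n) : Prop :=
  exists (m : nat) (a : 'I_m -> 'rV[R]_n) (c : 'I_m -> R),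
    P = [set x | forall i, dot (a i) x <= c i].

Definition is_polytope (R : realType) (n : nat) (P : set 'rV[R]_n.+1) : Prop :=
  [/\ P !=set0, is_polyhedron P & bounded_set P].

(* Nonempty faces, including P itself (w = 0). *)
Definition is_face (R : realType) (n : nat) (P F : set 'rV[R]_n) : Prop :=
  F !=set0 /\
  exists w : 'rV[R]_n,
    F = [set x | P x /\ forall y, P y -> dot w y <= dot w x].

(* A subset of W_d = R^(d+1) / R 1 is represented by its preimage in R^(d+1).
   In particular a linear functional that is bounded above on the preimage of
   a cone vanishes on 1, so the faces of a cone of W_d correspond to the faces
   (in the sense of is_face) of its preimage. *)

Definition normal_cone (R : realType) (n : nat) (P F : set 'rV[R]_n) :
    set 'rV[R]_n :=
  [set w | forall x y, F x -> P y -> dot w y <= dot w x].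

Definition normal_fan (R : realType) (n : nat) (P : set 'rV[R]_n) :
    set (set 'rV[R]_n) :=
  [set C | exists2 F, is_face P F & C = normal_cone P F].

(* lift ord0 i and widen_ord _ i are the positions i + 1 and i in [d+1]. *)
Definition Delta (R : realType) (d : nat) (pi : 'S_d.+1) (x : 'rV[R]_d.+1)
    (i : 'I_d) : R :=
  x 0 ((pi^-1)%g (lift ord0 i)) - x 0 ((pi^-1)%g (widen_ord (leqnSn d) i)).

Definition sigma (R : realType) (d : nat) (pi : 'S_d.+1) (tau : 'S_d) :
    set 'rV[R]_d.+1 :=
  [set x : 'rV[R]_d.+1 |
     (forall i j : 'I_d.+1, (i <= j)%N ->
        x 0 ((pi^-1)%g i) <= x 0 ((pi^-1)%g j)) /\
     (forall i j : 'I_d, (i <= j)%N ->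
        Delta pi x ((tau^-1)%g i) <= Delta pi x ((tau^-1)%g j))].

Definition nested_braid_fan (R : realType) (d : nat) :
    set (set 'rV[R]_d.+1) :=
  [set C | exists (pi : 'S_d.+1) (tau : 'S_d), is_face (sigma pi tau) C].

Definition coarsening (T : Type) (Sigma Sigma' : set (set T)) : Prop :=
  forall C, Sigma C ->
    exists2 D : set (set T), D `<=` Sigma' & C = \bigcup_(K in D) K.

Definition generalized_nested_permutohedron (R : realType) (d : nat)
    (P : set 'rV[R]_d.+1) : Prop :=
  [/\ is_polytope P,
      exists c : R, forall x : 'rV[R]_d.+1, P x -> \sum_i x 0 i = c
    & coarsening (normal_fan P) (@nested_braid_fan R d)].

Definition system_solutions (R : realType) (d : nat) (b : osp d -> R) :
    set 'rV[R]_d.+1 :=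
  [set x | dot (const_mx 1) x = b (osp_top d) /\
           forall T : osp d, T != osp_top d -> dot (e_osp R T) x <= b T].

Definition tight (R : realType) (d : nat) (b : osp d -> R) : Prop :=
  forall T : osp d, T != osp_top d ->
    exists2 x, system_solutions b x & dot (e_osp R T) x = b T.

(* Main.v *)
Require Import Defs.
From mathcomp Require Import all_boot all_order all_algebra all_fingroup.
From mathcomp Require Import zify ring lra reals.
Set Implicit Arguments.
Unset Strict Implicit.
Unset Printing Implicit Defensive.
Import Order.TTheory GRing.Theory Num.Theory.

(* A point satisfying with equality the inequalities of a maximal chain of
   [T(pi), top] is a candidate vertex, one for each cone sigma(pi, tau).  Given
   (1) and (2) all candidates satisfy the whole system; this is the convexity of
   the piecewise linear function f on the nested Braid fan with f(e_T) = b_T.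
   On a braid chamber f is the Lovasz extension of a submodular function, so
   there convexity is the greedy bound; across a wall x_a = x_c the two linear
   pieces differ by a multiple of x_a - x_c whose sign is given by (2) and the
   greedy bound.  Local convexity at points with at most one coincidence among
   the coordinates suffices, because a segment issued from a generic point of a
   cone meets no other points in its interior.  Conversely, the support function
   of a generalized nested permutohedron is linear on each sigma(pi, tau), and
   its subadditivity at e_S + e_T, resp. e_{T_0} + e_{T_0'}, is (1), resp. (2). *)

(** * Ordered set partitions and level functions *)

(** In a chamber ordered by pi, the first entry and the gaps serve as coordinates: every e_T of
    [T(pi), top] has first entry 1, and its gaps are the indicator of its set of bars. One
    inequality per wall suffices for the following reason. On a wall the vanishing gap is the
    smallest one, so tau lists it first, and the maximal chains on the two sides differ only in
    their bottom elements T_0 and T_0'. These satisfy e_{T_0} + e_{T_0'} + [i > 1] 1 = 2 e_T + e_S.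
    For i = 1 the empty first block of S is omitted, which lowers all weights of S by one; this is
    why b_{[d+1]} then disappears from (2). The function f is never defined as such: only candidate
    points are compared, so nothing has to be proved about its pieces agreeing on common faces. The
    scale on which midpoint convexity holds depends on the point, hence the passage to global
    convexity by a maximum principle. *)

Lemma is_ospP d (s : seq {set 'I_d.+1}) :
  reflect (set0 \notin s /\ forall j, count (fun B : {set _} => j \in B) s = 1%N)
          (is_osp s).
Proof.
apply: (iffP andP) => [[us /and3P[/eqP cov /trivIsetP triv n0]]|[n0 c1]].
  split=> [|j]; first by rewrite inE in n0.
  apply/eqP; rewrite eqn_leq -has_count; apply/andP; split; last first.
    have : j \in cover [set B in s] by rewrite cov.
    by case/bigcupP=> B; rewrite inE => Bs jB; apply/hasP; exists B.
  rewrite -size_filter; case E: (filter _ s) => [//|B t].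
  rewrite -E -[1%N]/(size [:: B]); apply: uniq_leq_size; first exact: filter_uniq.
  have: B \in [seq C : {set _} <- s | j \in C] by rewrite E mem_head.
  rewrite mem_filter => /andP[jB Bs] C; rewrite mem_filter => /andP[jC Cs].
  rewrite inE; apply: contraT => CB.
  have := triv C B; rewrite !inE => /(_ Cs Bs CB) /pred0P /(_ j) /=.
  by rewrite jB jC.
have two (j : 'I_d.+1) (A B : {set 'I_d.+1}) :
    A \in s -> B \in s -> j \in A -> j \in B -> A = B.
  move=> As Bs jA jB; apply/eqP; apply: contraT => AB.
  have : (size [:: A; B] <= size [seq B : {set _} <- s | j \in B])%N.
    apply: uniq_leq_size => [|C]; first by rewrite /= inE AB.
    by rewrite !inE => /orP[]/eqP->; rewrite mem_filter ?jA ?jB.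
  by rewrite size_filter c1.
split.
  apply: count_mem_uniq => B.
  have [Bs|] := boolP (B \in s); last by move/count_memPn.
  have [j jB] : exists j, j \in B.
    by apply/set0Pn; apply: contraNneq n0 => <-.
  have le1 : count_mem B s <= 1.
    by rewrite -(c1 j); apply: sub_count => C /eqP->.
  have gt0 : 0 < count_mem B s by rewrite -has_count has_pred1.
  by apply/eqP; rewrite eqn_leq le1.
apply/and3P; split; last by rewrite inE.
- apply/eqP/setP=> j; rewrite [RHS]inE; apply/bigcupP.
  have : has (fun B : {set _} => j \in B) s by rewrite has_count c1.
  by case/hasP=> B Bs jB; exists B; rewrite ?inE.
- apply/trivIsetP => A B; rewrite !inE => As Bs AB.
  apply/pred0P => j /=; apply: contraNF AB => /andP[jA jB].
  by apply/eqP; apply: (two j).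
Qed.

(** Encodes an ordered set partition as a surjection onto an initial segment of the naturals.
    Refinement becomes monotonicity, and e_T is [lev] plus one, so identities between e-vectors are
    identities of natural numbers. *)
Definition lev d (T : osp d) (j : 'I_d.+1) : nat :=
  find (fun B : {set 'I_d.+1} => j \in B) (val T).

Section Levels.
Variable d : nat.
Implicit Types (S T : osp d) (i j : 'I_d.+1) (t : nat).

Lemma osp_has T j : has (fun B : {set 'I_d.+1} => j \in B) (val T).
Proof. by rewrite has_count; have [_ ->] := is_ospP _ (valP T). Qed.

Lemma lev_lt T j : lev T j < size (val T).
Proof. by rewrite -has_find osp_has. Qed.

Lemma mem_block T j t : (j \in nth set0 (val T) t) = (lev T j == t).
Proof.
have jl : j \in nth set0 (val T) (lev T j) by exact: nth_find (osp_has T j).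
apply/idP/eqP => [jt|<- //].
have [tT|Tt] := ltnP t (size (val T)); last by rewrite nth_default ?inE in jt.
have /andP[uT _] := valP T.
apply/eqP; rewrite -(nth_uniq set0 _ _ uT) ?lev_lt //.
apply: contraT => neq.
have [_ /(_ j)] := is_ospP _ (valP T); rewrite -size_filter => c1.
have : (size [:: nth set0 (val T) (lev T j); nth set0 (val T) t]
          <= size [seq B : {set _} <- val T | j \in B])%N.
  apply: uniq_leq_size => [|C]; first by rewrite /= inE neq.
  by rewrite !inE => /orP[]/eqP->; rewrite mem_filter ?jt ?jl mem_nth ?lev_lt.
by rewrite c1.
Qed.

Lemma lev_onto T t : t < size (val T) -> exists j, lev T j = t.
Proof.
move=> tT; have [n0 _] := is_ospP _ (valP T).
have /set0Pn[j] : nth set0 (val T) t != set0.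
  by apply: contraNneq n0 => <-; apply: mem_nth.
by rewrite mem_block => /eqP; exists j.
Qed.

Lemma lev_inj S T : lev S =1 lev T -> S = T.
Proof.
move=> eST; apply/val_inj.
have sz : size (val S) = size (val T).
  apply/eqP; rewrite eqn_leq; apply/andP; split; rewrite leqNgt; apply/negP => lt.
    by have [j jl] := lev_onto lt; have := lev_lt T j; rewrite -(eST j) jl ltnn.
  by have [j jl] := lev_onto lt; have := lev_lt S j; rewrite (eST j) jl ltnn.
apply: (@eq_from_nth _ set0) => // t _.
by apply/setP => j; rewrite !mem_block (eST j).
Qed.

Lemma lev_exists (g : 'I_d.+1 -> nat) (k : nat) :
  (forall j, g j < k) -> (forall t, t < k -> exists j, g j = t) ->
  exists T, lev T =1 g.
Proof.
move=> gk ontog.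
pose s := mkseq (fun t => [set j | g j == t]) k.
have sP : is_osp s.
  apply/is_ospP; split.
    apply/mapP => -[t]; rewrite mem_iota => /ontog[j jt] /setP/(_ j).
    by rewrite !inE jt eqxx.
  move=> j; rewrite /s /mkseq count_map.
  rewrite (@eq_count _ _ (pred1 (g j))); last by move=> t; rewrite /= inE eq_sym.
  by rewrite count_uniq_mem ?iota_uniq // mem_iota gk.
exists (exist (fun s => is_osp s) s sP) => j.
apply/eqP; rewrite -mem_block /= nth_mkseq //.
by rewrite inE.
Qed.

Lemma flatten_filter_sorted (X : eqType) (f : X -> nat) (k m : nat) (s : seq X) :
  sorted (relpre f leq) s -> all (fun x => m <= f x < m + k) s ->
  flatten [seq [seq x <- s | f x == t] | t <- iota m k] = s.
Proof.
elim: k m s => [|k IH] m s srt bnd /=.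
  by case: s bnd {srt} => //= x s; rewrite addn0; lia.
have split_s : [seq x <- s | f x == m] ++ [seq x <- s | f x != m] = s.
  elim: s srt bnd {IH} => //= x s IH pth /andP[bx bs].
  have := IH (path_sorted pth) bs; case: eqP => [_ /= -> //|fx _].
  have al : all (fun y => f y != m) s.
    apply/allP => y ys.
    have /allP/(_ y ys)/= : all (relpre f leq x) s.
      by apply: order_path_min pth => a b c /=; apply: leq_trans.
    by move=> ?; apply/eqP; lia.
  rewrite (all_filterP al) (eq_in_filter (a2 := pred0)) ?filter_pred0 //.
  by move=> y /(allP al)/negbTE.
rewrite -[RHS]split_s; congr (_ ++ _).
have <- := IH m.+1 [seq x <- s | f x != m].
- congr flatten; apply/eq_in_map => t; rewrite mem_iota => ht.
  rewrite -filter_predI; apply: eq_filter => x /=.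
  by case: eqP => //= ->; apply/esym/eqP; lia.
- by apply: sorted_filter => // a b c /=; apply: leq_trans.
- apply/allP => x; rewrite mem_filter => /andP[fx xs].
  by have /= := allP bnd x xs; move: fx => /eqP; lia.
Qed.

Lemma osp_leP S T :
  osp_le S T <-> forall i j, lev S i <= lev S j -> lev T i <= lev T j.
Proof.
split=> [[runs fS fT] i j|mono].
  rewrite /lev -fS -fT.
  elim: runs {fS fT} => //= r rs IH; rewrite !find_cat.
  have memU k : (k \in \bigcup_(B <- r) B) = has (fun B : {set _} => k \in B) r.
    by elim: r {IH} => [|B r IHr]; rewrite ?big_nil ?inE //= big_cons inE IHr.
  rewrite !memU; case: ifP => // _.
  case: ifP => [jr le|_]; last by rewrite leq_add2l ltnS; apply: IH.
  by exfalso; rewrite has_find in jr; lia.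
(* Blocks are nonempty, so the default [ord0] is not taken on blocks of [S]; [memS] makes the choice
   of representative immaterial. *)
pose rep (B : {set 'I_d.+1}) := odflt ord0 [pick j in B].
have repP (B : {set 'I_d.+1}) : B \in val S -> rep B \in B.
  move=> BS; rewrite /rep; case: pickP => //= B0.
  have [n0 _] := is_ospP _ (valP S); case/negP: n0.
  suff <- : B = set0 by [].
  by apply/setP => j; rewrite inE; apply: B0.
have memS i j t : i \in nth set0 (val S) t -> j \in nth set0 (val S) t ->
    lev T i = lev T j.
  rewrite !mem_block => /eqP it /eqP jt.
  by apply/eqP; rewrite eqn_leq !mono // it jt.
(* A run collects the blocks sent to one level of [T]. Since [S] lists its blocks by nondecreasing
   level in [T], concatenating the runs gives back [S]. *)
exists [seq [seq B <- val S | lev T (rep B) == t] | t <- iota 0 (size (val T))].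
  apply: flatten_filter_sorted; last by apply/allP => B _; rewrite /= lev_lt.
  case E: (val S) => [//|B0 s]; rewrite -E; apply/(sortedP set0) => t tS /=.
  apply: mono; set i := rep _; set j := rep _.
  have it : i \in nth set0 (val S) t by apply/repP/mem_nth/ltnW.
  have jt : j \in nth set0 (val S) t.+1 by apply/repP/mem_nth.
  by move: it jt; rewrite !mem_block => /eqP-> /eqP->.
apply: (@eq_from_nth _ set0); first by rewrite !size_map size_iota.
move=> t; rewrite !size_map size_iota => tT.
rewrite -map_comp (nth_map 0) ?size_iota // nth_iota // add0n /=.
apply/setP => j; rewrite mem_block.
have memU (r : seq {set 'I_d.+1}) :
    (j \in \bigcup_(B <- r) B) = has (fun B : {set _} => j \in B) r.
  by elim: r => [|B r IHr]; rewrite ?big_nil ?inE //= big_cons inE IHr.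
rewrite memU; apply/hasP/eqP => [[B]|jt].
  rewrite mem_filter => /andP[/eqP<- BS] jB.
  have [u uS uB] := nthP set0 BS.
  by apply: (memS _ _ u); rewrite uB // repP.
have lS := lev_lt S j; have jl : j \in nth set0 (val S) (lev S j).
  by rewrite mem_block.
exists (nth set0 (val S) (lev S j)) => //.
rewrite mem_filter mem_nth // andbT -jt; apply/eqP.
by apply: (memS _ _ (lev S j)) => //; apply/repP/mem_nth.
Qed.

Lemma find_singletons j (p : seq 'I_d.+1) :
  find (fun B : {set 'I_d.+1} => j \in B) (singletons p) = index j p.
Proof.
by elim: p => //= i p ->; rewrite inE eq_sym; case: eqP.
Qed.

Lemma has_singletons j (p : seq 'I_d.+1) :
  has (fun B : {set 'I_d.+1} => j \in B) (singletons p) = (j \in p).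
Proof. by elim: p => //= i p ->; rewrite !inE. Qed.

Lemma count_singletons j (p : seq 'I_d.+1) :
  count (fun B : {set 'I_d.+1} => j \in B) (singletons p) = count_mem j p.
Proof. by elim: p => //= i p ->; rewrite inE eq_sym. Qed.

Lemma lev_perm (pi : 'S_d.+1) j : lev (osp_perm pi) j = pi j.
Proof.
rewrite /lev find_singletons /= -{1}(permK pi j) index_map; last exact: perm_inj.
by rewrite index_enum_ord.
Qed.

Lemma lev_top j : lev (osp_top d) j = 0.
Proof. by rewrite /lev /= inE. Qed.

Lemma in_intervalP (pi : 'S_d.+1) T :
  in_interval pi T <-> forall i j, pi i <= pi j -> lev T i <= lev T j.
Proof.
split=> [[/osp_leP mono _] i j ij|mono]; first by apply: mono; rewrite !lev_perm.
by split; apply/osp_leP => i j; rewrite ?lev_perm ?lev_top //; apply: mono.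
Qed.

Section Essential.
Variables (p q : seq 'I_d.+1) (s s' : 'I_d.+1) (T T0 T0' S : osp d).
Hypotheses (ss' : s != s')
  (vT : val T = singletons p ++ [set s; s'] :: singletons q)
  (vT0 : val T0 = singletons p ++ [set s] :: [set s'] :: singletons q)
  (vT0' : val T0' = singletons p ++ [set s'] :: [set s] :: singletons q)
  (vS : val S = [seq B <- [:: [set x in p]; [set s; s']; [set x in q]]
            | B != set0]).

Let levT j : lev T j = if j \in p then index j p else
  size p + (if (j == s) || (j == s') then 0 else (index j q).+1).
Proof.
rewrite /lev vT find_cat has_singletons find_singletons size_map /=.
by rewrite find_singletons !inE.
Qed.

Let levT0 j : lev T0 j = if j \in p then index j p else
  size p + (if j == s then 0 else if j == s' then 1 else (index j q).+2).
Proof.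
rewrite /lev vT0 find_cat has_singletons find_singletons size_map /=.
by rewrite find_singletons !inE; do 2 case: eqP => //.
Qed.

Let levT0' j : lev T0' j = if j \in p then index j p else
  size p + (if j == s' then 0 else if j == s then 1 else (index j q).+2).
Proof.
rewrite /lev vT0' find_cat has_singletons find_singletons size_map /=.
by rewrite find_singletons !inE; do 2 case: eqP => //.
Qed.

Let coverj j : [|| j \in p, j == s, j == s' | j \in q].
Proof.
by have := osp_has T j; rewrite vT has_cat has_singletons /= !inE has_singletons -orbA.
Qed.

Let levS j : lev S j = if j \in p then 0 else
  (p != [::]) + (if (j == s) || (j == s') then 0 else 1).
Proof.
have p0 : ([set x in p] != set0) = (p != [::]).
  case: p => [|x p'] /=; first by apply/eqP; apply/setP => x; rewrite !inE.
  by apply/set0Pn; exists x; rewrite !inE eqxx.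
have s0 : [set s; s'] != set0 by apply/set0Pn; exists s; rewrite !inE eqxx.
have q0 : j \in q -> [set x in q] != set0 by move=> jq; apply/set0Pn; exists j; rewrite inE.
rewrite /lev vS /= p0 s0; case: (eqVneq p [::]) (coverj j) => [-> /=|_ /=].
  rewrite !inE; case: eqP => //= _; case: eqP => //= _ jq.
  by rewrite q0 //= inE jq.
rewrite !inE; case: (j \in p) => //=; case: eqP => //= _; case: eqP => //= _ jq.
by rewrite q0 //= inE jq.
Qed.

(** The linear relation behind (2). The final 1 accounts for weights starting from 1, with three
    e-vectors on the right against two on the left. *)
Lemma essential_lev j :
  lev T0 j + lev T0' j + (p != [::]) = 2 * lev T j + lev S j + 1.
Proof.
rewrite levT levT0 levT0' levS; have [jp|jp] := boolP (j \in p).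
  have -> : p != [::] by apply: contraTneq jp => ->.
  by rewrite addn0 mul2n addnn.
case: (eqVneq j s) => [->|js]; first by rewrite (negbTE ss') /= ?eqxx; lia.
by case: (eqVneq j s') => [_|js'] /=; lia.
Qed.

Lemma essential_le_mid : osp_le T0 T.
Proof.
apply/osp_leP => i j; rewrite !levT !levT0.
have [jp|jp] := boolP (j \in p).
  case: ifP => // ip; rewrite -index_mem in jp => le.
  by have := leq_ltn_trans (leq_trans (leq_addr _ _) le) jp; rewrite ltnn.
case: ifP => ip; first by move=> _; rewrite (leq_trans (index_size _ _)) ?leq_addr.
rewrite !leq_add2l.
by case: (i == s); case: (i == s'); case: (j == s); case: (j == s').
Qed.

Lemma essential_le_top : osp_le T S.
Proof.
apply/osp_leP => i j; rewrite !levT !levS.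
have [jp|jp] := boolP (j \in p).
  case: ifP => // ip; rewrite -index_mem in jp => le.
  by have := leq_ltn_trans (leq_trans (leq_addr _ _) le) jp; rewrite ltnn.
case: ifP => // ip.
rewrite !leq_add2l.
by case: (i == s); case: (i == s'); case: (j == s); case: (j == s').
Qed.

End Essential.

Lemma essential_exists (p q : seq 'I_d.+1) (s s' : 'I_d.+1) :
  perm_eq (p ++ s :: s' :: q) (enum 'I_d.+1) ->
  exists T T0 T0' S : osp d,
  [/\ val T = singletons p ++ [set s; s'] :: singletons q,
      val T0 = singletons p ++ [set s] :: [set s'] :: singletons q,
      val T0' = singletons p ++ [set s'] :: [set s] :: singletons q
    & val S = [seq B <- [:: [set x in p]; [set s; s']; [set x in q]]
            | B != set0]].
Proof.
move=> pe.
have cj j : count_mem j (p ++ s :: s' :: q) = 1.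
  by rewrite (seq.permP pe) count_uniq_mem ?enum_uniq // mem_enum.
have up : uniq (p ++ s :: s' :: q) by rewrite (perm_uniq pe) enum_uniq.
have sing0 (r : seq 'I_d.+1) : set0 \notin singletons r.
  by apply/mapP => -[i _ /setP/(_ i)]; rewrite !inE eqxx.
have set10 (i : 'I_d.+1) : (set0 == [set i]) = false.
  by apply/eqP => /setP/(_ i); rewrite !inE eqxx.
have set20 : (set0 == [set s; s']) = false.
  by apply/eqP => /setP/(_ s); rewrite !inE eqxx.
have ss' : (s == s') = false.
  by move: up; rewrite cat_uniq /= inE negb_or; case: (s == s'); rewrite /= ?andbF.
have [upp uq] : uniq p /\ uniq q.
  by move: up; rewrite cat_uniq /= => /and3P[-> _ /and3P[_ _ ->]].
have e2 (j : 'I_d.+1) : ((j == s) || (j == s') : nat) = (j == s) + (j == s').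
  by have [->|//] := eqVneq j s; rewrite ss'.
have oT : is_osp (singletons p ++ [set s; s'] :: singletons q).
  apply/is_ospP; split; first by rewrite mem_cat inE !negb_or !sing0 set20.
  move=> j; rewrite count_cat /= !count_singletons -(cj j) count_cat /= !inE.
  by rewrite (eq_sym s) (eq_sym s') e2 !addnA.
have oT0 : is_osp (singletons p ++ [set s] :: [set s'] :: singletons q).
  apply/is_ospP; split; first by rewrite mem_cat !inE !negb_or !sing0 !set10.
  move=> j; rewrite count_cat /= !count_singletons -(cj j) count_cat /= !inE.
  by rewrite (eq_sym s) (eq_sym s').
have oT0' : is_osp (singletons p ++ [set s'] :: [set s] :: singletons q).
  apply/is_ospP; split; first by rewrite mem_cat !inE !negb_or !sing0 !set10.
  move=> j; rewrite count_cat /= !count_singletons -(cj j) count_cat /= !inE.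
  by rewrite (eq_sym s) (eq_sym s'); congr (_ + _); rewrite addnCA.
have oS : is_osp [seq B <- [:: [set x in p]; [set s; s']; [set x in q]] | B != set0].
  apply/is_ospP; split; first by rewrite mem_filter eqxx.
  move=> j; rewrite count_filter (@eq_count _ _ (fun B : {set _} => j \in B)).
    rewrite -(cj j) count_cat /= !inE !count_uniq_mem //= (eq_sym s) (eq_sym s').
    by rewrite e2 addn0 !addnA.
  by move=> B /=; rewrite andb_idr // => jB; apply/set0Pn; exists j.
exists (exist (fun s => is_osp s) _ oT), (exist (fun s => is_osp s) _ oT0).
by exists (exist (fun s => is_osp s) _ oT0'), (exist (fun s => is_osp s) _ oS).
Qed.

End Levels.

Local Open Scope ring_scope.

(** * Permutations that sort a family of reals *)

Lemma sorting_perm (R : realDomainType) n (f : 'I_n -> R) :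
  exists s : 'S_n, forall i j : 'I_n, (i <= j)%N -> f ((s^-1)%g i) <= f ((s^-1)%g j).
Proof.
pose r := relpre f (fun x y : R => x <= y).
pose l := sort r (enum 'I_n).
have sl : size l = n by rewrite size_sort size_enum_ord.
have ul : uniq l by rewrite sort_uniq enum_uniq.
have rt : total r by move=> i j; exact: le_total.
have rtr : transitive r by move=> i j k; exact: le_trans.
pose g (i : 'I_n) := nth i l i.
have gE (x0 i : 'I_n) : g i = nth x0 l i by apply: set_nth_default; rewrite sl.
have gi : injective g.
  move=> i j; rewrite (gE i) (gE i j) => /eqP.
  by rewrite nth_uniq ?sl // => /eqP; exact: val_inj.
exists (perm gi)^-1%g => i j ij; rewrite invgK !permE (gE i) (gE i j).
have := sorted_leq_nth rtr _ i (sort_sorted rt (enum 'I_n)).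
apply=> //; first by move=> k; exact: lexx.
- by rewrite inE -/l sl.
- by rewrite inE -/l sl.
Qed.

Lemma strict_perm_ge n (s : 'S_n) :
  (forall i j : 'I_n, (i < j)%N -> (s i < s j)%N) -> forall i : 'I_n, (i <= s i)%N.
Proof.
move=> mono i; have [m] := ubnP (val i).
elim: m i => // m IH i; rewrite ltnS => im; rewrite leqNgt; apply/negP => si.
by have := IH _ (leq_trans si im); rewrite leqNgt mono.
Qed.

Lemma strict_perm1 n (s : 'S_n) :
  (forall i j : 'I_n, (i < j)%N -> (s i < s j)%N) -> s = 1%g.
Proof.
move=> mono; apply/permP => i; rewrite perm1; apply/val_inj/eqP.
rewrite eqn_leq strict_perm_ge // andbT.
have := @strict_perm_ge _ (s^-1)%g _ (s i); rewrite permK; apply=> j k jk.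
rewrite ltnNge; apply/negP => le; move: jk.
rewrite -{1}(permKV s j) -{1}(permKV s k) ltnNge => /negP; apply.
move: le; rewrite leq_eqVlt => /orP[/eqP/val_inj -> //|/mono/ltnW//].
Qed.

(** The strict order makes [s^-1] followed by [s'] strictly increasing, hence the identity. *)
Lemma sorting_perm_uniq (R : realDomainType) n (f : 'I_n -> R) (s s' : 'S_n) :
  (forall i j : 'I_n, (i < j)%N -> f ((s^-1)%g i) < f ((s^-1)%g j)) ->
  (forall i j : 'I_n, (i <= j)%N -> f ((s'^-1)%g i) <= f ((s'^-1)%g j)) ->
  s = s'.
Proof.
move=> ms ms'; apply/eqP; rewrite eq_sym -(inj_eq (mulgI (s^-1)%g)) mulVg.
apply/eqP/strict_perm1 => i j ij; rewrite !permM ltnNge; apply/negP => /ms'.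
by rewrite !permK leNgt ms.
Qed.

(** * The interval [T(pi), top] as the Boolean lattice of sets of bars *)

Section Bars.
Variable d : nat.
Implicit Types (pi : 'S_d.+1) (A B : {set 'I_d}) (T : osp d).

Let cnt A m := #|[set i in A | (i < m)%N]|.

Let cnt0 A : cnt A 0 = 0%N.
Proof. by apply: eq_card0 => i; rewrite !inE andbF. Qed.

Let cntS A (i : 'I_d) : cnt A i.+1 = ((i \in A) + cnt A i)%N.
Proof.
rewrite /cnt (cardsD1 i) !inE ltnSn andbT; congr (_ + _)%N.
apply: eq_card => k; rewrite !inE ltnS leq_eqVlt.
by case: eqVneq => [->|ki] /=; [rewrite ltnn andbF|rewrite (inj_eq val_inj) (negbTE ki)].
Qed.

Let cntd A m : (d <= m)%N -> cnt A m = #|A|.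
Proof.
by move=> dm; apply: eq_card => i; rewrite !inE (leq_trans (ltn_ord i) dm) andbT.
Qed.

(** The number of bars before a position grows by at most one per step, so it takes every value up
    to [#|A|]. The boolean quantifier makes [xchoose] applicable. *)
Lemma ospb_exists pi A :
  exists T, [forall j, lev T j == #|[set i in A | (i < pi j)%N]|].
Proof.
suff [T eT] : exists T, lev T =1 (fun j => #|[set i in A | (i < pi j)%N]|).
  by exists T; apply/forallP => j; rewrite (eT j).
apply: (lev_exists (k := #|A|.+1)) => [j|t].
  by rewrite ltnS; apply/subset_leq_card/subsetP => i; rewrite !inE => /andP[].
rewrite ltnS -(cntd A (leqnn d)) => tA.
have [m md mt] : exists2 m, (m <= d)%N & cnt A m = t.
  suff aux m : (m <= d)%N -> (t <= cnt A m)%N ->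
      exists2 m', (m' <= d)%N & cnt A m' = t by exact: aux tA.
  elim: m {tA} => [_|m IH md]; first by rewrite cnt0 leqn0 => /eqP->; exists 0%N.
  rewrite leq_eqVlt => /orP[/eqP->|]; first by exists m.+1.
  have -> : m.+1 = (Ordinal md).+1 by [].
  rewrite cntS /= => tlt; have {tlt} : (t <= cnt A m)%N by case: (_ \in _) tlt; lia.
  by move/(IH (ltnW md)).
by exists ((pi^-1)%g (inord m)); rewrite permKV inordK.
Qed.

(* The element of [T(pi), top] whose bars are exactly those after the
   positions in A. *)
Definition ospb pi A : osp d := xchoose (ospb_exists pi A).

Lemma lev_ospb pi A j : lev (ospb pi A) j = #|[set i in A | (i < pi j)%N]|.
Proof. exact/eqP/(forallP (xchooseP (ospb_exists pi A))). Qed.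

Lemma ospb_in pi A : in_interval pi (ospb pi A).
Proof.
apply/in_intervalP => i j ij; rewrite !lev_ospb.
apply/subset_leq_card/subsetP => k; rewrite !inE => /andP[-> /=].
by move/leq_trans; apply.
Qed.

Lemma lev_ospbS pi A (i : 'I_d) :
  lev (ospb pi A) ((pi^-1)%g (lift ord0 i)) =
  ((i \in A) + lev (ospb pi A) ((pi^-1)%g (widen_ord (leqnSn d) i)))%N.
Proof. by rewrite !lev_ospb !permKV /= -[RHS]cntS. Qed.

(** Merging blocks removes bars, so inclusion is reversed: joins are intersections of bar sets and
    meets are unions. *)
Lemma ospb_le pi A B : osp_le (ospb pi A) (ospb pi B) <-> B \subset A.
Proof.
split=> [/osp_leP le|BA].
  apply/subsetP => i iB; apply: contraT => iA.
  have := le ((pi^-1)%g (lift ord0 i)) ((pi^-1)%g (widen_ord (leqnSn d) i)).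
  by rewrite !lev_ospbS (negbTE iA) iB leqnn add1n ltnn => /(_ isT).
have ext A' j : lev (ospb pi A') j = cnt A' (pi j) by rewrite lev_ospb.
apply/osp_leP => i j; rewrite !ext leqNgt => le; rewrite leqNgt.
apply: contra le => lt.
have ij : (pi j < pi i)%N.
  rewrite ltnNge; apply/negP => ij; move: lt; rewrite ltnNge => /negP; apply.
  by rewrite -!ext; have /in_intervalP := ospb_in pi B; apply.
have -> : cnt A (pi j) = #|[set k in A | (k < pi j)%N]| by [].
apply: proper_card; apply/properP; split.
  by apply/subsetP => k; rewrite !inE => /andP[-> /ltn_trans]; apply.
have : cnt B (pi j) != cnt B (pi i) by rewrite neq_ltn lt.
have [/existsP[k /and3P[kB ki kj]]|/existsPn no] :=
    boolP [exists k : 'I_d, [&& k \in B, (k < pi i)%N & ~~ (k < pi j)%N]].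
  by move=> _; exists k; rewrite !inE (subsetP BA) //= ki // (negbTE kj).
case/eqP; apply: eq_card => k; rewrite !inE.
have [kB /=|//] := boolP (k \in B).
have := no k; rewrite kB /= negb_and negbK => /orP[|kj]; last by rewrite kj (ltn_trans kj).
by move=> nk; rewrite (negbTE nk); apply: contraNF nk => /ltn_trans; apply.
Qed.

Lemma in_interval_ospb pi T : in_interval pi T -> exists A, T = ospb pi A.
Proof.
move=> /in_intervalP mono.
pose A := [set i : 'I_d | lev T ((pi^-1)%g (lift ord0 i))
   != lev T ((pi^-1)%g (widen_ord (leqnSn d) i))].
exists A; apply: lev_inj => j; rewrite -(permK pi j).
case: (pi j) => m /=; elim: m => [|m IH] md.
  rewrite lev_ospb permKV /= -[RHS]/(cnt A 0) cnt0.
  have [k k0] := @lev_onto _ T 0 (leq_ltn_trans (leq0n _) (lev_lt T j)).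
  have : (lev T ((pi^-1)%g (Ordinal md)) <= lev T k)%N by apply: mono; rewrite permKV.
  by rewrite k0 leqn0 => /eqP.
pose i : 'I_d := Ordinal (md : (m < d)%N).
have -> : Ordinal md = lift ord0 i by apply: val_inj.
rewrite lev_ospbS.
have wi : widen_ord (leqnSn d) i = Ordinal (ltnW md) by apply: val_inj.
rewrite wi -IH [i \in A]inE wi.
set a := lev T _; set c := lev T _.
have ca : (c <= a)%N by apply: mono; rewrite !permKV /=.
(* A larger jump would skip level [c.+1]. Some element has that level, and it sits on one side of
   the step, against monotonicity. *)
have : (a <= c.+1)%N.
  rewrite leqNgt; apply/negP => lt.
  have [k kc] := @lev_onto _ T c.+1 (ltn_trans lt (lev_lt T _)).
  have [km|mk] := leqP (pi k) m.
    have : (lev T k <= c)%N by apply: mono; rewrite permKV.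
    by rewrite kc ltnn.
  have : (a <= lev T k)%N by apply: mono; rewrite permKV.
  by rewrite kc leqNgt lt.
by case: eqVneq; lia.
Qed.

Lemma ospb0 pi : ospb pi set0 = osp_top d.
Proof.
apply: lev_inj => j; rewrite lev_top lev_ospb.
by apply: eq_card0 => i; rewrite !inE.
Qed.

Lemma ospbT pi : ospb pi [set: 'I_d] = osp_perm pi.
Proof.
apply: lev_inj => j; rewrite lev_perm lev_ospb.
have -> : [set i in [set: 'I_d] | (i < pi j)%N] = [set i : 'I_d | (i < pi j)%N].
  by apply/setP => i; rewrite !inE.
have lej : (pi j <= d)%N by rewrite -ltnS.
rewrite cardsE -sum1_card -[RHS]card_ord -sum1_card.
by rewrite (big_ord_widen _ (fun=> 1%N) lej).
Qed.

Lemma ospb_join pi A B : is_join pi (ospb pi A) (ospb pi B) (ospb pi (A :&: B)).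
Proof.
split; rewrite ?ospb_le ?subsetIl ?subsetIr //; first exact: ospb_in.
move=> U /in_interval_ospb[C ->]; rewrite !ospb_le => CA CB.
by rewrite subsetI CA.
Qed.

Lemma ospb_meet pi A B : is_meet pi (ospb pi A) (ospb pi B) (ospb pi (A :|: B)).
Proof.
split; rewrite ?ospb_le ?subsetUl ?subsetUr //; first exact: ospb_in.
move=> U /in_interval_ospb[C ->]; rewrite !ospb_le => CA CB.
by rewrite subUset CA.
Qed.

Lemma join_ospb pi A B J : is_join pi (ospb pi A) (ospb pi B) J -> J = ospb pi (A :&: B).
Proof.
case=> /in_interval_ospb[C ->]; rewrite !ospb_le => CA CB.
move=> /(_ _ (ospb_in pi (A :&: B))); rewrite !ospb_le subsetIl subsetIr.
move=> /(_ isT isT) AC; congr ospb; apply/eqP.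
by rewrite eqEsubset AC subsetI CA CB.
Qed.

Lemma meet_ospb pi A B M : is_meet pi (ospb pi A) (ospb pi B) M -> M = ospb pi (A :|: B).
Proof.
case=> /in_interval_ospb[C ->]; rewrite !ospb_le => CA CB.
move=> /(_ _ (ospb_in pi (A :|: B))); rewrite !ospb_le subsetUl subsetUr.
move=> /(_ isT isT) AC; congr ospb; apply/eqP.
by rewrite eqEsubset AC subUset CA CB.
Qed.

End Bars.

(** * Cones and candidate vertices *)

(** On sigma(pi, tau), the positions of all but the m smallest gaps. Taken as bars for m = 0, ...,
    d, they give the maximal chain of the cone, from T(pi) up to the top. *)
Definition upset d (tau : 'S_d) (m : nat) : {set 'I_d} := [set i | (m <= tau i)%N].

Section Upset.
Variables (d : nat) (tau : 'S_d).

Lemma upset0 : upset tau 0 = [set: 'I_d].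
Proof. by apply/setP => i; rewrite !inE. Qed.

Lemma upset_big m : (d <= m)%N -> upset tau m = set0.
Proof.
by move=> dm; apply/setP => i; rewrite !inE leqNgt (leq_trans (ltn_ord _) dm).
Qed.

Lemma upsetS (k : 'I_d) : upset tau k = (tau^-1)%g k |: upset tau k.+1.
Proof.
apply/setP => i; rewrite !inE leq_eqVlt; congr (_ || _).
by rewrite (inj_eq val_inj) -{1}(permKV tau k) (inj_eq perm_inj) eq_sym.
Qed.

Lemma upset_ind (P : nat -> Prop) :
  (forall m, (d <= m)%N -> P m) -> (forall k : 'I_d, P k.+1 -> P k) ->
  forall m, P m.
Proof.
move=> base step m; have [n] := ubnP (d - m)%N; elim: n m => // n IH m nm.
have [/base//|md] := leqP d m.
by apply: (step (Ordinal md)); apply: IH => /=; lia.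
Qed.

Variables (R : realDomainType) (g : {set 'I_d} -> R).
Let gain i := g (upset tau (tau i)) - g (upset tau (tau i).+1).

Lemma gain_chain m : \sum_(i in upset tau m) gain i = g (upset tau m) - g set0.
Proof.
elim/upset_ind: m => [m dm|k IH]; first by rewrite upset_big // big_set0 subrr.
rewrite upsetS big_setU1 /=; last by rewrite inE permKV ltnn.
by rewrite IH /gain permKV -upsetS; ring.
Qed.

(* Greedy bound: adding an element to a smaller set gains more, so the marginal
   gains along the chain of upsets never sum to more than [g] allows. *)
Lemma gain_le (A : {set 'I_d}) :
  (forall B C, g (B :&: C) + g (B :|: C) <= g B + g C) ->
  \sum_(i in A) gain i <= g A - g set0.
Proof.
move=> sub.
suff aux m : \sum_(i in A :&: upset tau m) gain i <= g (A :&: upset tau m) - g set0.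
  by have := aux 0%N; rewrite upset0 setIT.
elim/upset_ind: m => [m dm|k IH].
  by rewrite upset_big // setI0 big_set0 subrr.
have [kA|kA] := boolP ((tau^-1)%g k \in A); last first.
  suff -> : A :&: upset tau k = A :&: upset tau k.+1 by [].
  apply/setP => i; rewrite upsetS !inE; have [->|//] := eqVneq i.
  by rewrite (negbTE kA).
have -> : A :&: upset tau k = (tau^-1)%g k |: A :&: upset tau k.+1.
  apply/setP => i; rewrite upsetS !inE; have [->|//] := eqVneq i.
  by rewrite kA.
rewrite big_setU1 /=; last by rewrite !inE permKV ltnn andbF.
rewrite /gain permKV.
have := sub ((tau^-1)%g k |: A :&: upset tau k.+1) (upset tau k.+1).
have -> : ((tau^-1)%g k |: A :&: upset tau k.+1) :&: upset tau k.+1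
  = A :&: upset tau k.+1.
  apply/setP => i; rewrite !inE; have [->|] := eqVneq i; rewrite ?permKV ?ltnn ?andbF //=.
  by rewrite -andbA andbb.
have -> : ((tau^-1)%g k |: A :&: upset tau k.+1) :|: upset tau k.+1 = upset tau k.
  by rewrite upsetS -setUA; congr (_ :|: _); apply/setUidPr; apply: subsetIr.
by move: IH; lra.
Qed.

End Upset.

(** * Scalar products, e-vectors and gap coordinates *)

Section Dot.
Variables (R : realType) (n : nat).
Implicit Types (u v w : 'rV[R]_n).

Lemma dotDl u v w : dot (u + v) w = dot u w + dot v w.
Proof. by rewrite /dot -big_split; apply: eq_bigr => i _; rewrite mxE mulrDl. Qed.

Lemma dotZl a u w : dot (a *: u) w = a * dot u w.
Proof. by rewrite /dot mulr_sumr; apply: eq_bigr => i _; rewrite mxE mulrA. Qed.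

Lemma dotNl u w : dot (- u) w = - dot u w.
Proof. by rewrite -scaleN1r dotZl mulN1r. Qed.

Lemma dotBl u v w : dot (u - v) w = dot u w - dot v w.
Proof. by rewrite dotDl dotNl. Qed.

Lemma dot_suml I (r : seq I) (F : I -> 'rV[R]_n) w :
  dot (\sum_(i <- r) F i) w = \sum_(i <- r) dot (F i) w.
Proof.
elim/big_rec2: _ => [|i y x _ <-]; last by rewrite dotDl.
by rewrite /dot big1 // => i _; rewrite mxE mul0r.
Qed.

Lemma dotC u v : dot u v = dot v u.
Proof. by apply: eq_bigr => i _; rewrite mulrC. Qed.

Lemma dot1 v : dot (const_mx 1) v = \sum_i v 0 i.
Proof. by apply: eq_bigr => i _; rewrite mxE mul1r. Qed.

Lemma dot_delta i v : dot (delta_mx 0 i) v = v 0 i.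
Proof.
rewrite /dot (bigD1 i) //= big1 ?addr0 ?mxE ?eqxx ?mul1r // => j /negbTE ji.
by rewrite mxE ji andbF mul0r.
Qed.

End Dot.

Definition adj_tperm d (i : 'I_d) : 'S_d.+1 :=
  tperm (widen_ord (leqnSn d) i) (lift ord0 i).

Section EVectors.
Variables (R : realType) (d : nat).
Implicit Types (T : osp d) (pi : 'S_d.+1) (tau : 'S_d) (w : 'rV[R]_d.+1).

Lemma e_ospE T j : e_osp R T 0 j = (lev T j).+1%:R.
Proof.
rewrite /e_osp summxE (bigD1 (Ordinal (lev_lt T j))) //= [X in _ + X]big1 => [|t tj].
  rewrite addr0 !mxE summxE (bigD1 j) ?mem_block //= big1 => [|k /andP[_ /negbTE kj]].
    by rewrite mxE !eqxx addr0 mulr1.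
  by rewrite mxE eq_sym kj andbF.
rewrite !mxE summxE big1 ?mulr0 // => k; rewrite mem_block => kt.
rewrite mxE eqxx /=; have [jk|//] := eqVneq j k; case/negP: tj.
by apply/eqP/val_inj/esym/eqP; rewrite /= jk.
Qed.

Lemma e_top : e_osp R (osp_top d) = const_mx 1.
Proof. by apply/rowP => j; rewrite e_ospE lev_top mxE. Qed.

Lemma DeltaD pi w w' i : Delta pi (w + w') i = Delta pi w i + Delta pi w' i.
Proof. by rewrite /Delta !mxE; ring. Qed.

Lemma DeltaZ pi a w i : Delta pi (a *: w) i = a * Delta pi w i.
Proof. by rewrite /Delta !mxE; ring. Qed.

Lemma Delta_const pi a i : Delta pi (const_mx a : 'rV[R]_d.+1) i = 0.
Proof. by rewrite /Delta !mxE subrr. Qed.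

Lemma Delta_ospb pi A i : Delta pi (e_osp R (ospb pi A)) i = (i \in A)%:R.
Proof.
rewrite /Delta !e_ospE lev_ospbS -[in LHS]addn1 -[(lev _ _).+1]addn1 !natrD.
by ring.
Qed.

Lemma sum_Delta pi w j :
  w 0 j = w 0 ((pi^-1)%g ord0) + \sum_(i < d | (i < pi j)%N) Delta pi w i.
Proof.
pose c k := w 0 ((pi^-1)%g (inord k)).
have lej : (pi j <= d)%N by rewrite -ltnS.
rewrite (eq_bigr (fun i : 'I_d => c i.+1 - c i)) => [|i _]; last first.
  have -> : i.+1 = lift ord0 i by [].
  have -> : (i : nat) = widen_ord (leqnSn d) i by [].
  by rewrite /c !inord_val.
rewrite -(big_ord_widen _ (fun i => c i.+1 - c i) lej).
rewrite -(big_mkord xpredT (fun i => c i.+1 - c i)) telescope_sumr //.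
rewrite /c addrCA -[X in _ = _ + (_ - w 0 (_ X))](_ : ord0 = _).
  by rewrite subrr addr0 inord_val permK.
by apply: val_inj; rewrite /= inordK.
Qed.

(** The gaps sorted by [tau], shifted by one so that the value at 0 is 0 and the first increment is
    the smallest gap itself. The default 0 only fills indices beyond [d]. *)
Definition slope pi tau w (m : nat) : R :=
  if m is k.+1 then oapp (fun i => Delta pi w ((tau^-1)%g i)) 0 (insub k) else 0.

Definition coef pi tau w (k : 'I_d) : R :=
  slope pi tau w k.+1 - slope pi tau w k.

Lemma slopeS pi tau w (k : 'I_d) : slope pi tau w k.+1 = Delta pi w ((tau^-1)%g k).
Proof. by rewrite /= (valK k). Qed.

Lemma coef_first pi tau w (k : 'I_d) :
  k = 0%N :> nat -> coef pi tau w k = Delta pi w ((tau^-1)%g k).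
Proof. by move=> k0; rewrite /coef slopeS k0 subr0. Qed.

(* Summation by parts. *)
Lemma decomposition pi tau w :
  w = (w 0 ((pi^-1)%g ord0) - \sum_k coef pi tau w k) *: const_mx 1
      + \sum_k coef pi tau w k *: e_osp R (ospb pi (upset tau k)).
Proof.
apply/rowP => j; rewrite !mxE summxE mulr1.
(* Weights start from 1, so each e-vector contributes its coefficient once besides its levels; the
   coefficient of [const_mx 1] subtracts exactly these contributions. *)
rewrite [X in _ = _ + X](eq_bigr (fun k => coef pi tau w k +
   \sum_(i < d | (i < pi j)%N && (k <= tau i)%N) coef pi tau w k)); last first.
  move=> k _; rewrite mxE e_ospE lev_ospb sumr_const mulrS mulrDr mulr1; congr (_ + _).
  rewrite mulr_natr; congr (_ *+ _); apply: eq_card => i.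
  by rewrite !inE andbC unfold_in.
rewrite [X in _ = _ + X]big_split /= addrA subrK {1}(sum_Delta pi w j); congr (_ + _).
rewrite (exchange_big_dep (fun i : 'I_d => (i < pi j)%N)) /=; last by move=> ? ? _ /andP[].
apply: eq_bigr => i ij; rewrite (eq_bigl (fun k : 'I_d => (k < (tau i).+1)%N)); last first.
  by move=> k; rewrite ij.
rewrite -(big_ord_widen _ (fun m => slope pi tau w m.+1 - slope pi tau w m) (ltn_ord (tau i))).
rewrite -(big_mkord xpredT (fun m => slope pi tau w m.+1 - slope pi tau w m)).
by rewrite telescope_sumr // slopeS permK subr0.
Qed.

Lemma subsetIU (A B : {set 'I_d}) : A :&: B \subset A :|: B.
Proof. exact: subset_trans (subsetIl _ _) (subsetUl _ _). Qed.

(** Levels count bars, and cardinality is modular. *)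
Lemma e_ospbIU pi (A B : {set 'I_d}) :
  e_osp R (ospb pi (A :&: B)) + e_osp R (ospb pi (A :|: B))
    = e_osp R (ospb pi A) + e_osp R (ospb pi B).
Proof.
apply/rowP => j; rewrite !mxE !e_ospE !lev_ospb -!natrD; congr (_%:R).
rewrite !addSn !addnS; congr _.+2.
have cardI (X : {set 'I_d}) : [set i in X | (i < pi j)%N] = X :&: [set i : 'I_d | (i < pi j)%N].
  by apply/setP => i; rewrite !inE.
by rewrite !cardI addnC setIUl setIIl cardsUI.
Qed.

Definition chamber pi w : Prop := forall i j : 'I_d.+1, (i <= j)%N ->
  w 0 ((pi^-1)%g i) <= w 0 ((pi^-1)%g j).

Lemma chamber_Delta pi w i : chamber pi w -> 0 <= Delta pi w i.
Proof. by move=> ch; rewrite /Delta subr_ge0; apply: ch; rewrite /= /bump leq0n leq_addl. Qed.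

Lemma coef_ge0 pi tau w k : sigma pi tau w -> 0 <= coef pi tau w k.
Proof.
move=> [ch srt]; rewrite /coef slopeS subr_ge0.
case: k => -[|k] kd /=; first exact: chamber_Delta.
by rewrite (valK (Ordinal (ltnW kd))) /=; apply: srt => /=.
Qed.

Lemma in_intervalE pi T : in_interval pi T <-> chamber pi (e_osp R T).
Proof.
split=> [/in_intervalP mono i j ij|ch].
  by rewrite !e_ospE ler_nat ltnS mono // !permKV.
apply/in_intervalP => i j ij.
by have := ch _ _ ij; rewrite !permK !e_ospE ler_nat ltnS.
Qed.

Lemma chamber_exists w : exists pi, chamber pi w.
Proof. exact: (sorting_perm (fun j => w 0 j)). Qed.

Lemma chamber_sigma pi w : chamber pi w -> exists tau, sigma pi tau w.
Proof. by move=> ch; have [tau] := sorting_perm (Delta pi w); exists tau. Qed.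

Lemma sigma_exists w : exists pi tau, sigma pi tau w.
Proof. by have [pi /chamber_sigma[tau]] := chamber_exists w; exists pi, tau. Qed.

(** By [decomposition] the cone is spanned by its chain vectors with nonnegative coefficients and by
    the line of the all-one vector, so it is enough to compare on these. *)
Lemma sigma_le pi tau w v v' : sigma pi tau w ->
  dot (const_mx 1) v = dot (const_mx 1) v' ->
  (forall k : 'I_d, dot (e_osp R (ospb pi (upset tau k))) v
     <= dot (e_osp R (ospb pi (upset tau k))) v') ->
  dot w v <= dot w v'.
Proof.
move=> sw v1 vk; rewrite (decomposition pi tau w) !dotDl !dotZl v1.
rewrite lerD2l !dot_suml; apply: ler_sum => k _; rewrite !dotZl.
by rewrite ler_wpM2l ?coef_ge0.
Qed.

Lemma ospb_sigma pi tau (A : {set 'I_d}) :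
  (forall i j, (tau i <= tau j)%N -> i \in A -> j \in A) ->
  sigma pi tau (e_osp R (ospb pi A)).
Proof.
move=> up; split; first by have /in_intervalE := ospb_in pi A.
move=> i j ij; rewrite !Delta_ospb ler_nat.
by have := up ((tau^-1)%g i) ((tau^-1)%g j); rewrite !permKV => /(_ ij); do 2 case: (_ \in _) => //; move=> ->.
Qed.

Lemma chain_sigma pi tau m : sigma pi tau (e_osp R (ospb pi (upset tau m))).
Proof. by apply: ospb_sigma => i j ij; rewrite !inE => /leq_trans; apply. Qed.

(** The only e-vectors in a cone are those of its chain. Hence the inequality of T is an equality at
    the candidate vertex of any cone containing e_T. *)
Lemma sigma_upset pi tau (A : {set 'I_d}) : sigma pi tau (e_osp R (ospb pi A)) ->
  exists m, A = upset tau m.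
Proof.
move=> [_ srt].
have up i j : (tau i <= tau j)%N -> i \in A -> j \in A.
  move=> /srt; rewrite !permK !Delta_ospb ler_nat.
  by case: (i \in A) => //; case: (j \in A).
have [->|[i0 i0A]] := set_0Vmem A; first by exists d; rewrite upset_big.
case: (arg_minnP (fun k => tau k : nat) i0A) => i iA mini; exists (tau i); apply/setP => j; rewrite inE.
by apply/idP/idP => [/mini//|/up]; apply.
Qed.

Lemma nested_sigma pi (A B : {set 'I_d}) : B \subset A -> exists tau,
  sigma pi tau (e_osp R (ospb pi A)) /\ sigma pi tau (e_osp R (ospb pi B)).
Proof.
move=> /subsetP BA.
(* Sorting positions by how many of the two sets contain them puts [B] last, preceded by the rest of
   [A], so both sets are upsets of [tau]. *)
have [tau srt] := sorting_perm (fun i : 'I_d => ((i \in A) + (i \in B))%:R : R).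
have mono i j : (tau i <= tau j)%N -> ((i \in A) + (i \in B) <= (j \in A) + (j \in B))%N.
  by move=> /srt; rewrite !permK ler_nat.
exists tau; split; apply: ospb_sigma => i j /mono le iX; move: le; rewrite iX.
  by case jA: (j \in A) => //; rewrite (contraFF (BA j) jA).
by rewrite (BA i iX); case: (j \in A); case: (j \in B).
Qed.

End EVectors.

(** * Candidate vertices, the greedy bound and the essential inequalities *)

Section Vertices.
Variables (R : realType) (d : nat) (b : osp d -> R).
Implicit Types (T : osp d) (pi : 'S_d.+1) (tau : 'S_d) (w v : 'rV[R]_d.+1).

(** The linear function agreeing with [b] on the chain of the cone, written in the first entry and
    the gaps; [vert] reads its coefficients off the standard basis. *)
Let form pi tau w : R := w 0 ((pi^-1)%g ord0) * b (osp_top d) +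
  \sum_i Delta pi w i * (b (ospb pi (upset tau (tau i)))
                         - b (ospb pi (upset tau (tau i).+1))).

(* The point at which the inequalities of the maximal chain spanning
   sigma(pi, tau) are all equalities. *)
Definition vert pi tau : 'rV[R]_d.+1 := \row_j form pi tau (delta_mx 0 j).

Let dot_vert pi tau w : dot w (vert pi tau) = form pi tau w.
Proof.
have formD u v : form pi tau (u + v) = form pi tau u + form pi tau v.
  rewrite /form mxE mulrDl addrACA; congr (_ + _); rewrite -big_split.
  by apply: eq_bigr => i _; rewrite DeltaD mulrDl.
have formZ a u : form pi tau (a *: u) = a * form pi tau u.
  rewrite /form mxE mulrDr mulrA; congr (_ + _); rewrite mulr_sumr.
  by apply: eq_bigr => i _; rewrite DeltaZ mulrA.
rewrite [in RHS](row_sum_delta w) /dot (big_morph _ formD (id1 := 0)).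
  by apply: eq_bigr => j _; rewrite formZ mxE.
by rewrite -(scale0r w) formZ mul0r.
Qed.

Lemma dot_top_vert pi tau : dot (const_mx 1) (vert pi tau) = b (osp_top d).
Proof.
rewrite dot_vert /form mxE mul1r big1 ?addr0 // => i _.
by rewrite Delta_const mul0r.
Qed.

Let dot_ospb_vert pi tau A : dot (e_osp R (ospb pi A)) (vert pi tau) =
  b (osp_top d) + \sum_(i in A) (b (ospb pi (upset tau (tau i)))
                         - b (ospb pi (upset tau (tau i).+1))).
Proof.
rewrite dot_vert /form; congr (_ + _).
  rewrite e_ospE lev_ospb permKV eq_card0 ?mul1r // => i.
  by rewrite !inE andbF.
rewrite [RHS]big_mkcond; apply: eq_bigr => i _.
by rewrite Delta_ospb; case: ifP => _; rewrite ?mul1r ?mul0r.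
Qed.

Lemma dot_chain_vert pi tau m :
  dot (e_osp R (ospb pi (upset tau m))) (vert pi tau) = b (ospb pi (upset tau m)).
Proof.
rewrite dot_ospb_vert (gain_chain tau (fun A => b (ospb pi A))).
by rewrite ospb0; ring.
Qed.

Lemma vert_le_sigma pi tau w v : sigma pi tau w ->
  dot (const_mx 1) v = b (osp_top d) ->
  (forall k : 'I_d, dot (e_osp R (ospb pi (upset tau k))) v
     <= b (ospb pi (upset tau k))) ->
  dot w v <= dot w (vert pi tau).
Proof.
move=> sw v1 vk; apply: (sigma_le sw) => [|k]; first by rewrite dot_top_vert.
by rewrite dot_chain_vert.
Qed.

Hypothesis sub : locally_submodular b.

Lemma vert_le_interval pi tau T : in_interval pi T -> dot (e_osp R T) (vert pi tau) <= b T.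
Proof.
move=> /in_interval_ospb[A ->]; rewrite dot_ospb_vert.
have := gain_le (g := fun A => b (ospb pi A)) tau A.
rewrite ospb0 -lerBrDl; apply=> B C; rewrite addrC.
rewrite [leLHS]addrC; apply: (sub (pi := pi)); try exact: ospb_in.
  exact: ospb_join.
exact: ospb_meet.
Qed.

(** On one chamber f is thus the maximum of its linear pieces, and its value at [w] does not depend
    on which cone of the chamber is chosen around [w]. *)
Lemma vert_le_chamber pi tau tau' w : sigma pi tau' w ->
  dot w (vert pi tau) <= dot w (vert pi tau').
Proof.
move=> sw; apply: vert_le_sigma => // [|k]; first exact: dot_top_vert.
by apply: vert_le_interval; apply: ospb_in.
Qed.

Lemma chamber_vert pi w : chamber pi w -> exists2 tau',
  sigma pi tau' w & forall tau, dot w (vert pi tau) <= dot w (vert pi tau').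
Proof.
by move=> /chamber_sigma[tau' sw]; exists tau' => // tau; apply: vert_le_chamber.
Qed.

Hypothesis ess : essential_inequalities b.


Let perm_split pi (i : 'I_d) : exists p q : seq 'I_d.+1,
  let s := (pi^-1)%g (widen_ord (leqnSn d) i) in
  let s' := (pi^-1)%g (lift ord0 i) in
  [/\ [seq (pi^-1)%g k | k <- enum 'I_d.+1] = p ++ s :: s' :: q
    & [seq ((pi * adj_tperm i)^-1)%g k | k <- enum 'I_d.+1] = p ++ s' :: s :: q].
Proof.
set a := widen_ord (leqnSn d) i; set c := lift ord0 i.
pose e1 := take i (enum 'I_d.+1); pose e2 := drop i.+2 (enum 'I_d.+1).
have en : enum 'I_d.+1 = e1 ++ a :: c :: e2.
  have id1 : (i < d.+1)%N by exact: leq_trans (ltn_ord i) (leqnSn d).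
  rewrite -[LHS](cat_take_drop i); congr (_ ++ _).
  rewrite (drop_nth ord0) ?size_enum_ord // (drop_nth ord0) ?size_enum_ord ?ltnS //.
  congr [:: _, _ & _]; apply: val_inj => /=; first by rewrite nth_enum_ord.
  by rewrite nth_enum_ord // ltnS.
exists [seq (pi^-1)%g k | k <- e1], [seq (pi^-1)%g k | k <- e2] => s s'.
have : uniq (e1 ++ a :: c :: e2) by rewrite -en enum_uniq.
rewrite cat_uniq !cons_uniq inE negb_or => /and4P[_ hs /andP[_ a2] /andP[c2 _]].
move: hs; rewrite /= !negb_or => /and3P[a1 c1 _].
have tfix k : k != a -> k != c -> ((pi * adj_tperm i)^-1)%g k = (pi^-1)%g k.
  by move=> ka kc; rewrite invMg permM tpermV tpermD // eq_sym.
split; rewrite en map_cat /= //; congr (_ ++ [:: _, _ & _]).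
- apply/eq_in_map => k ke; apply: tfix; first by apply: contraNneq a1 => <-.
  by apply: contraNneq c1 => <-.
- by rewrite invMg permM tpermV tpermL.
- by rewrite invMg permM tpermV tpermR.
- apply/eq_in_map => k ke; apply: tfix; first by apply: contraNneq a2 => <-.
  by apply: contraNneq c2 => <-.
Qed.

Lemma essential_e p q s s' (T T0 T0' S : osp d) : s != s' ->
  val T = singletons p ++ [set s; s'] :: singletons q ->
  val T0 = singletons p ++ [set s] :: [set s'] :: singletons q ->
  val T0' = singletons p ++ [set s'] :: [set s] :: singletons q ->
  val S = [seq B <- [:: [set x in p]; [set s; s']; [set x in q]] | B != set0] ->
  e_osp R T0 + e_osp R T0' + (p != [::])%:R *: const_mx 1
    = 2 *: e_osp R T + e_osp R S.
Proof.
move=> ss' vT vT0 vT0' vS; apply/rowP => j; rewrite !mxE !e_ospE mulr1.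
have := essential_lev ss' vT vT0 vT0' vS j => /(congr1 (fun n : nat => n%:R : R)).
rewrite !natrD -!natr1; lra.
Qed.

(** The only use of (2). At a vertex of the neighbouring chamber T_0' is tight, while T and S lie in
    that chamber's interval and obey the greedy bound. Solving the linear relation for e_{T_0}
    bounds its value there, and (2) says that this bound is at most b_{T_0}. *)
Lemma essential_vert pi tau i :
  dot (e_osp R (osp_perm pi)) (vert (pi * adj_tperm i)%g tau) <= b (osp_perm pi).
Proof.
have [p [q [E E']]] := perm_split pi i.
set s := (pi^-1)%g _ in E E'; set s' := (pi^-1)%g (lift _ _) in E E'.
have ss' : s != s'.
  by rewrite (inj_eq perm_inj) -val_eqE /= neq_ltn /bump leq0n add1n ltnSn.
have [|T [T0 [T0' [S [vT vT0 vT0' vS]]]]] := @essential_exists d p q s s'.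
  rewrite -E; apply: uniq_perm; last 1 first.
  - move=> k; rewrite mem_enum; apply/mapP; exists (pi k); rewrite ?mem_enum //.
    by rewrite permK.
  - by rewrite map_inj_uniq ?enum_uniq //; exact: perm_inj.
  - exact: enum_uniq.
have e0 : T0 = osp_perm pi by apply: val_inj; rewrite vT0 /= E /singletons map_cat.
have e0' : T0' = osp_perm (pi * adj_tperm i)%g.
  by apply: val_inj; rewrite vT0' /= E' /singletons map_cat.
have rk : osp_rank T = 1%N.
  rewrite /osp_rank vT size_cat /= !size_map.
  have := congr1 size E; rewrite size_map size_enum_ord size_cat /=; lia.
have iT : in_interval (pi * adj_tperm i)%g T.
  (* The block {s, s'} is unordered, so T refines to T_0' as well: [essential_le_mid] applies with s
     and s' exchanged. *)
  rewrite in_intervalP; have vT' := vT; rewrite setUC in vT'.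
  have /osp_leP le := essential_le_mid vT' vT0'.
  by move=> j k jk; apply: le; rewrite e0' !lev_perm.
have iS : in_interval (pi * adj_tperm i)%g S.
  rewrite in_intervalP => j k jk; have /osp_leP := essential_le_top vT vS.
  by apply; apply/(iffLR (in_intervalP _ _) iT).
have key := ess rk ss' vT vT0 vT0' vS.
have := congr1 (fun x => dot x (vert (pi * adj_tperm i)%g tau)) (essential_e ss' vT vT0 vT0' vS).
rewrite /= !dotDl !dotZl dot_top_vert e0.
have -> : dot (e_osp R T0') (vert (pi * adj_tperm i)%g tau) = b T0'.
  by rewrite e0' -(ospbT (pi * adj_tperm i)%g) -(upset0 tau) dot_chain_vert.
have := vert_le_interval tau iT; have := vert_le_interval tau iS.
rewrite e0 in key.
case: (p) key => [|? ?] /=; lra.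
Qed.

End Vertices.

(** * Local convexity *)

(** Finitely many strict inequalities survive a common small step in both directions; this replaces
    the topology of open cones. *)
Lemma exists_step (R : realFieldType) (I : finType) (x y : I -> R) (delta : R) :
  0 < delta -> exists2 s, 0 < s <= delta
    & forall i, 0 < x i -> (0 < x i + s * y i) /\ (0 < x i - s * y i).
Proof.
move=> d0.
suff [s /andP[s0 sd] H] : exists2 s, 0 < s <= delta
    & forall i, i \in enum I -> 0 < x i -> s * `|y i| < x i.
  exists s; first by rewrite s0.
  move=> i /(H i (mem_enum _ _)); rewrite -{1}(gtr0_norm s0) -normrM ltr_norml.
  by case/andP; split; lra.
elim: (enum I) => [|i l [s /andP[s0 sd] H]]; first by exists delta; rewrite ?d0 ?lexx.
have [xi|xi] := ltP 0 (x i); last first.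
  exists s; rewrite ?s0 // => j; rewrite inE => /orP[/eqP->|/H//].
  by rewrite ltNge xi.
(* The added 1 avoids a zero denominator and makes the resulting bound strict. *)
pose s' := x i / (1 + `|y i|).
have y0 : 0 <= `|y i| by exact: normr_ge0.
have s'0 : 0 < s' by rewrite divr_gt0 // ltr_wpDr.
exists (Num.min s s'); first by rewrite lt_min s0 s'0 ge_min sd.
move=> j; rewrite inE => /orP[/eqP->|jl] xj; last first.
  by apply: le_lt_trans (H j jl xj); rewrite ler_wpM2r // ge_min lexx.
apply: (@le_lt_trans _ _ (s' * `|y i|)); first by rewrite ler_wpM2r // ge_min lexx orbT.
rewrite /s' mulrAC ltr_pdivrMr ?ltr_wpDr // ltr_pM2l //; lra.
Qed.

Lemma double_le (R : realFieldType) (x y p q : R) :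
  x + y <= p -> x - y <= q -> 2 * x <= p + q.
Proof. lra. Qed.

(** At most one wall of the Braid arrangement passes through [z]. *)
Definition one_tie (R : realType) (d : nat) (z : 'rV[R]_d.+1) : Prop :=
  forall a c a' c', a != c -> a' != c' -> z 0 a = z 0 c -> z 0 a' = z 0 c' ->
    (a' = a /\ c' = c) \/ (a' = c /\ c' = a).

Section Local.
Variables (R : realType) (d : nat) (b : osp d -> R).
Hypotheses (sub : locally_submodular b) (ess : essential_inequalities b).
Implicit Types (pi : 'S_d.+1) (tau : 'S_d) (w z u : 'rV[R]_d.+1).

(** A partition without a bar at position [i] does not notice the swap of the two entries there. As
    [tau] lists [i] first, this covers every chain member but the bottom one, whose coefficient is
    the gap of [u] at [i]; [u] itself may lie in any cone. *)
Lemma wall_monotone pi tau (i : 'I_d) u : tau i = 0%N :> nat -> 0 <= Delta pi u i ->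
  dot u (vert b (pi * adj_tperm i)%g tau) <= dot u (vert b pi tau).
Proof.
move=> ti ui; rewrite {1 2}(decomposition pi tau u) !dotDl !dotZl !dot_top_vert.
rewrite lerD2l !dot_suml; apply: ler_sum => k _; rewrite !dotZl dot_chain_vert.
have [k0|k0] := posnP k.
  rewrite coef_first // ler_wpM2l //.
    have -> // : (tau^-1)%g k = i.
    by apply/(canLR (permK tau)); apply: val_inj; rewrite /= k0 ti.
  by rewrite k0 upset0 ospbT essential_vert.
suff -> : ospb pi (upset tau k) = ospb (pi * adj_tperm i)%g (upset tau k).
  by rewrite dot_chain_vert.
apply: lev_inj => j; rewrite !lev_ospb; apply: eq_card => l; rewrite !inE.
have [kl|//] := boolP (k <= tau l)%N.
have li : l != i :> nat by apply: contraTneq kl => /val_inj ->; rewrite ti -ltnNge.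
rewrite /= permM; case: tpermP => [->|->|//] /=; rewrite /bump leq0n add1n ltnS.
  by rewrite [RHS]leq_eqVlt (negbTE li).
by rewrite leq_eqVlt (negbTE li).
Qed.

Let locally_convex_dir z u pi tau s : sigma pi tau z ->
  chamber pi (z + s *: u) -> chamber pi (z - s *: u) ->
  exists c c' : 'S_d.+1 * 'S_d,
  [/\ sigma c.1 c.2 (z + s *: u), sigma c'.1 c'.2 (z - s *: u)
    & 2 * dot z (vert b pi tau) <=
      dot (z + s *: u) (vert b c.1 c.2) + dot (z - s *: u) (vert b c'.1 c'.2)].
Proof.
move=> sz /(chamber_vert sub)[t1 s1 h1] /(chamber_vert sub)[t2 s2 h2].
exists (pi, t1), (pi, t2); split => //=.
apply: (@double_le _ _ (dot (s *: u) (vert b pi tau))); first by rewrite -dotDl h1.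
by rewrite -dotBl h2.
Qed.

(** Near [z] only the pair [a], [c] can change order: one end of the segment stays in the chamber of
    [pi], the other passes to its neighbour, and [wall_monotone] controls the change of linear
    piece. *)
Let locally_convex_wall z u pi tau s a c : sigma pi tau z -> one_tie z -> 0 < s ->
  (forall x y, z 0 x < z 0 y -> z 0 x + s * u 0 x < z 0 y + s * u 0 y /\
                                z 0 x - s * u 0 x < z 0 y - s * u 0 y) ->
  z 0 a = z 0 c -> (pi a < pi c)%N -> u 0 a <= u 0 c ->
  exists c c' : 'S_d.+1 * 'S_d,
  [/\ sigma c.1 c.2 (z + s *: u), sigma c'.1 c'.2 (z - s *: u)
    & 2 * dot z (vert b pi tau) <=
      dot (z + s *: u) (vert b c.1 c.2) + dot (z - s *: u) (vert b c'.1 c'.2)].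
Proof.
move=> [ch srt] tie s0 H zac piac uac.
have ac : a != c by apply: contraTneq piac => ->; rewrite ltnn.
(* An entry strictly between the positions of [a] and [c] would be tied with both. *)
have adj : pi c = (pi a).+1 :> nat.
  apply/eqP; rewrite eqn_leq piac andbT leqNgt; apply/negP => lt.
  pose k := (pi^-1)%g (inord (pi a).+1).
  have pk : pi k = (pi a).+1 :> nat.
    by rewrite permKV inordK // (leq_trans lt) // ltnW.
  have zak : z 0 a = z 0 k.
    apply/eqP; rewrite eq_le; apply/andP; split.
      by have := ch (pi a) (pi k); rewrite !permK pk; apply.
    by rewrite zac; have := ch (pi k) (pi c); rewrite !permK pk; apply; exact: ltnW.
  have ak : a != k by apply/eqP => ak; move: pk; rewrite -ak; lia.
  case: (tie a c a k ac ak zac zak) => -[h1 h2].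
    by rewrite h2 in pk; move: lt; rewrite pk ltnn.
  by rewrite h1 eqxx in ac.
have pia : (pi a < d)%N by rewrite -ltnS -adj.
pose i : 'I_d := Ordinal pia.
have iw : widen_ord (leqnSn d) i = pi a by apply: val_inj.
have il : lift ord0 i = pi c by apply: val_inj; rewrite /= adj.
have Di w : Delta pi w i = w 0 c - w 0 a by rewrite /Delta iw il !permK.
have Dk k : k != i -> 0 < Delta pi z k.
  move=> ki; rewrite lt_neqAle (chamber_Delta _ ch) andbT; apply/eqP => Dk0.
  pose x := (pi^-1)%g (widen_ord (leqnSn d) k); pose y := (pi^-1)%g (lift ord0 k).
  have zxy : z 0 x = z 0 y by apply/esym/eqP; rewrite -subr_eq0; apply/eqP/esym.
  have xy : x != y.
    by rewrite (inj_eq perm_inj) -val_eqE /= /bump leq0n add1n neq_ltn ltnSn.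
  have pxk : pi x = k :> nat by rewrite permKV.
  have pyk : pi y = k.+1 :> nat by rewrite permKV.
  case: (tie a c x y ac xy zac zxy) => -[h1 h2].
    by case/eqP: ki; apply: val_inj; rewrite /= -pxk h1.
  by move: pxk pyk; rewrite h1 h2 adj; lia.
(* The tied gap is zero and all others are positive, so it comes first in [tau]. *)
have ti : tau i = 0%N :> nat.
  apply/eqP; rewrite -leqn0 leqNgt; apply/negP => t0.
  have d0 : (0 < d)%N by exact: leq_ltn_trans (leq0n _) (ltn_ord i).
  pose k := (tau^-1)%g (Ordinal d0).
  have tk : tau k = 0%N :> nat by rewrite permKV.
  have ki : k != i by apply: contraTneq t0 => <-; rewrite tk.
  have := srt (tau k) (tau i); rewrite !permK tk => /(_ isT).
  by rewrite leNgt => /negP; apply; rewrite [ltLHS]Di zac subrr Dk.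
set pi' := (pi * adj_tperm i)%g.
have pi'V k : (pi'^-1)%g k = (pi^-1)%g (adj_tperm i k).
  by rewrite invMg permM tpermV.
have tK k : z 0 ((pi^-1)%g (adj_tperm i k)) = z 0 ((pi^-1)%g k).
  by rewrite /adj_tperm iw il; case: tpermP => // ->; rewrite !permK.
have ch1 : chamber pi (z + s *: u).
  move=> j k jk; rewrite !mxE.
  have [/H[/ltW]//|zjk] := ltP (z 0 ((pi^-1)%g j)) (z 0 ((pi^-1)%g k)).
  have {}zjk : z 0 ((pi^-1)%g j) = z 0 ((pi^-1)%g k) by apply/le_anti; rewrite zjk ch.
  have [->//|jk'] := eqVneq j k.
  have jkp : (pi^-1)%g j != (pi^-1)%g k by rewrite (inj_eq perm_inj).
  case: (tie a c _ _ ac jkp zac zjk) => -[h1 h2]; rewrite h1 h2.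
    by rewrite zac lerD2l ler_pM2l.
  move: jk; rewrite -(permKV pi j) -(permKV pi k) h1 h2 leqNgt.
  by rewrite piac.
have ch2 : chamber pi' (z - s *: u).
  move=> j k jk; rewrite !pi'V !mxE.
  set x := (pi^-1)%g (adj_tperm i j); set y := (pi^-1)%g (adj_tperm i k).
  have zle : z 0 x <= z 0 y by rewrite !tK ch.
  have [/H[_ /ltW]//|zyx] := ltP (z 0 x) (z 0 y).
  have {}zjk : z 0 x = z 0 y by apply/le_anti; rewrite zyx zle.
  have [->//|xy] := eqVneq x y.
  case: (tie a c _ _ ac xy zac zjk) => -[h1 h2]; rewrite h1 h2; last first.
    by rewrite zac lerD2l lerN2 ler_pM2l.
  exfalso; move: jk.
  have -> : j = pi c.
    have := congr1 pi h1; rewrite permKV => /(canRL (tpermK _ _)) ->.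
    by rewrite -iw tpermL il.
  have -> : k = pi a.
    have := congr1 pi h2; rewrite permKV => /(canRL (tpermK _ _)) ->.
    by rewrite -il tpermR iw.
  by rewrite leqNgt piac.
have [t1 s1 h1] := chamber_vert sub ch1.
have [t2 s2 h2] := chamber_vert sub ch2.
exists (pi, t1), (pi', t2); split => //=.
have Du : 0 <= Delta pi u i by rewrite Di subr_ge0.
have Dz0 : Delta pi z i = 0 by rewrite Di zac subrr.
have wu := wall_monotone ti Du.
(* At [z] the gap vanishes, so monotonicity applies to both [z] and [- z]: the two pieces agree
   there. *)
have wz : dot z (vert b pi' tau) = dot z (vert b pi tau).
  apply/le_anti/andP; split; first by apply: wall_monotone; rewrite ?Dz0.
  have := @wall_monotone pi tau i (- z) ti; rewrite !dotNl lerN2; apply.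
  by rewrite Di !mxE zac subrr.
apply: (@double_le _ _ (dot (s *: u) (vert b pi tau))); first by rewrite -dotDl h1.
apply: le_trans (h2 tau); rewrite dotBl wz lerD2l lerN2 !dotZl.
by rewrite ler_pM2l.
Qed.

Lemma local_midpoint_convex z u pi tau delta : sigma pi tau z -> one_tie z -> 0 < delta ->
  exists2 s, 0 < s <= delta & exists c c' : 'S_d.+1 * 'S_d,
  [/\ sigma c.1 c.2 (z + s *: u), sigma c'.1 c'.2 (z - s *: u)
    & 2 * dot z (vert b pi tau) <=
      dot (z + s *: u) (vert b c.1 c.2) + dot (z - s *: u) (vert b c'.1 c'.2)].
Proof.
move=> sz tie /(exists_step (fun p : 'I_d.+1 * 'I_d.+1 => z 0 p.2 - z 0 p.1)
                  (fun p => u 0 p.2 - u 0 p.1))[s /andP[s0 sd] Hs].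
exists s; first by rewrite s0.
have H x y : z 0 x < z 0 y -> z 0 x + s * u 0 x < z 0 y + s * u 0 y /\
                              z 0 x - s * u 0 x < z 0 y - s * u 0 y.
  by move=> xy; have := Hs (x, y); rewrite /= subr_gt0 => /(_ xy)[]; split; lra.
(* Either [u] separates a tied pair and the segment crosses the wall through [z], or tied entries
   move together and small steps stay in the chamber. *)
have [/existsP[[a c] /= /and3P[/eqP zac piac uac]]|/existsPn no] :=
    boolP [exists p : 'I_d.+1 * 'I_d.+1,
      [&& z 0 p.1 == z 0 p.2, (pi p.1 < pi p.2)%N & u 0 p.1 != u 0 p.2]].
  have [le|lt] := leP (u 0 a) (u 0 c); first exact: (locally_convex_wall sz tie s0 H zac).
  (* In the opposite orientation the two ends of the segment are exchanged. *)
  have [||c1 [c2 [h1 h2 h3]]] := @locally_convex_wall z (- u) pi tau s a c sz tie s0 _ zac piac.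
  - move=> x y /H; rewrite !mxE !mulrN !opprK => -[]; split; lra.
  - by rewrite !mxE lerN2 ltW.
  rewrite scalerN opprK in h1 h2 h3.
  by exists c2, c1; split => //; rewrite addrC.
have eqz (j k : 'I_d.+1) : (j <= k)%N -> ~~ (z 0 ((pi^-1)%g j) < z 0 ((pi^-1)%g k)) ->
    z 0 ((pi^-1)%g j) = z 0 ((pi^-1)%g k) /\ u 0 ((pi^-1)%g j) = u 0 ((pi^-1)%g k).
  move=> jk; rewrite -leNgt => le.
  have zz : z 0 ((pi^-1)%g j) = z 0 ((pi^-1)%g k) by apply/le_anti; rewrite le (proj1 sz).
  split=> //; have [->//|njk] := eqVneq j k.
  have := no ((pi^-1)%g j, (pi^-1)%g k); rewrite /= zz eqxx !permKV ltn_neqAle jk.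
  by rewrite (inj_eq val_inj) njk /= negbK => /eqP.
apply: locally_convex_dir => // j k jk; rewrite !mxE.
- have [/H[/ltW]//|nlt] := boolP (z 0 ((pi^-1)%g j) < z 0 ((pi^-1)%g k)).
  by have [-> ->] := eqz _ _ jk nlt.
- have [/H[_ /ltW]//|nlt] := boolP (z 0 ((pi^-1)%g j) < z 0 ((pi^-1)%g k)).
  by have [-> ->] := eqz _ _ jk nlt.
Qed.

End Local.

(** * From local to global convexity *)

Lemma exists_nonroot (R : numDomainType) (p : {poly R}) :
  p != 0 -> exists n : nat, ~~ root p n.+1%:R.
Proof.
move=> p0; pose rs := [seq n.+1%:R : R | n <- iota 0 (size p)].
have [/allP al|/allPn[_ /mapP[n _ ->]]] := boolP (all (root p) rs); last by exists n.
have urs : uniq rs.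
  rewrite map_inj_uniq ?iota_uniq // => i j /eqP.
  by rewrite eqr_nat eqSS => /eqP.
by have := max_poly_roots p0 (introT allP al) urs; rewrite size_map size_iota ltnn.
Qed.

Lemma segment_tie (R : comNzRingType) (t x y x' y' : R) :
  (1 - t) * x + t * y = (1 - t) * x' + t * y' ->
  (1 - t) * (x' - x) + t * (y' - y) = 0.
Proof.
move=> e; transitivity (((1 - t) * x' + t * y') - ((1 - t) * x + t * y)); first by ring.
by rewrite e subrr.
Qed.

Lemma pred_between m n : (m < n)%N -> (m <= n.-1 < n)%N.
Proof. by case: n => // n; rewrite ltnS => ->/=. Qed.

Lemma pred_lt_leq n k : (n.-1 < k)%N -> (n <= k)%N.
Proof. by case: n. Qed.

(** * Interior points of cones and generic segments *)

Section Gaps.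
Variables (R : realType) (d : nat).
Implicit Types (pi : 'S_d.+1) (tau : 'S_d) (x y : 'rV[R]_d.+1).

Definition sigma_interior pi tau x : Prop :=
  (forall i j : 'I_d.+1, (i < j)%N -> x 0 ((pi^-1)%g i) < x 0 ((pi^-1)%g j)) /\
  (forall i j : 'I_d, (i < j)%N ->
     Delta pi x ((tau^-1)%g i) < Delta pi x ((tau^-1)%g j)).

Lemma sigma_interior_uniq pi tau pi' tau' x :
  sigma_interior pi tau x -> sigma pi' tau' x -> pi' = pi /\ tau' = tau.
Proof.
move=> [ip it] [sp st].
have e : pi = pi' by apply: (sorting_perm_uniq (f := fun j => x 0 j)).
rewrite -e in st *; split=> //.
by apply/esym/(sorting_perm_uniq (f := Delta pi x)).
Qed.

Lemma sigma_interiorW pi tau x : sigma_interior pi tau x -> sigma pi tau x.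
Proof.
move=> [ip it]; split=> i j; rewrite leq_eqVlt => /orP[/eqP/val_inj -> //|].
  by move/ip/ltW.
by move/it/ltW.
Qed.

Definition of_gaps pi (g : 'I_d -> R) : 'rV[R]_d.+1 :=
  \row_j \sum_(i < d | (i < pi j)%N) g i.

Lemma of_gapsB pi g a c : (pi a <= pi c)%N ->
  of_gaps pi g 0 c - of_gaps pi g 0 a = \sum_(i < d | (pi a <= i < pi c)%N) g i.
Proof.
move=> ac; rewrite !mxE (bigID (fun i : 'I_d => (i < pi a)%N)) /=.
rewrite (eq_bigl (fun i : 'I_d => (i < pi a)%N)); last first.
  by move=> i; rewrite andb_idl // => /leq_trans; apply.
rewrite addrC addrK; apply: eq_bigl => i.
by rewrite -leqNgt andbC.
Qed.

Lemma Delta_of_gaps pi g i : Delta pi (of_gaps pi g) i = g i.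
Proof.
rewrite /Delta of_gapsB ?permKV /= /bump ?leq0n ?leq_addl // (big_pred1 i) // => j /=.
by rewrite add1n ltnS -eqn_leq -val_eqE eq_sym.
Qed.

Let pol (tau : 'S_d) (I : pred 'I_d) : {poly R} := \sum_(i | I i) 'X^((tau i).+1).

Let coef_pol (tau : 'S_d) (I : pred 'I_d) k : (pol tau I)`_(tau k).+1 = (I k)%:R.
Proof.
rewrite /pol coef_sum; have [Ik|Ik] := boolP (I k).
  rewrite (bigD1 k) //= coefXn eqxx big1 ?addr0 // => i /andP[_ ik].
  by rewrite coefXn eqSS (inj_eq val_inj) (inj_eq perm_inj) eq_sym (negbTE ik).
rewrite big1 // => i Ii; rewrite coefXn eqSS (inj_eq val_inj) (inj_eq perm_inj).
by case: eqVneq => // ki; rewrite -ki (negbTE Ik) in Ii.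
Qed.

(* A point of the interior whose gaps are powers of a generic number; a double
   tie on the segment would make that number a root of one of finitely many
   nonzero polynomials. *)
Lemma generic_segment pi tau y : exists2 x, sigma_interior pi tau x &
  forall t, 0 < t < 1 -> one_tie (x + t *: (y - x)).
Proof.
pose I a c := [pred i : 'I_d | (pi a <= i < pi c)%N].
(* Two ties at the same [t] read (1 - t) P + t q = 0 and (1 - t) P' + t q' = 0. Eliminating [t]
   leaves q' P = q P', whose difference is this polynomial at the generic number. *)
pose Q (p : ('I_d.+1 * 'I_d.+1) * ('I_d.+1 * 'I_d.+1)) :=
  (y 0 p.2.2 - y 0 p.2.1) *: pol tau (I p.1.1 p.1.2)
  - (y 0 p.1.2 - y 0 p.1.1) *: pol tau (I p.2.1 p.2.2).
(* The factor X - 1 excludes the value 1, so that s > 1 and the gaps increase strictly along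
   [tau]. *)
have [n Hn] : exists n : nat, ~~ root (('X - 1%:P) * \prod_(p | Q p != 0) Q p) n.+1%:R.
  apply: exists_nonroot; rewrite mulf_neq0 ?polyXsubC_eq0 //.
  by apply/prodf_neq0.
set s : R := n.+1%:R in Hn.
have s1 : 1 < s.
  rewrite /s ltr1n; case: n @s Hn => // s.
  by rewrite rootM root_XsubC eqxx.
have s0 : 0 < s by apply: lt_trans s1.
have HQ p : root (Q p) s -> Q p = 0.
  move=> rp; apply: contraNeq Hn => Qp; rewrite rootM; apply/orP; right.
  by rewrite rootE horner_prod; apply/prodf_eq0; exists p.
pose x := of_gaps pi (fun i => s ^+ (tau i).+1).
have xB a c : (pi a <= pi c)%N -> x 0 c - x 0 a = (pol tau (I a c)).[s].
  move=> ac; rewrite of_gapsB // /pol horner_sum.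
  by apply: eq_bigr => i _; rewrite hornerXn.
have xlt a c : (pi a < pi c)%N -> x 0 a < x 0 c.
  move=> ac; rewrite -subr_gt0 /x of_gapsB; last exact: ltnW.
  have pad : (pi a < d)%N by rewrite (leq_trans ac) // -ltnS.
  rewrite (bigD1 (Ordinal pad)) /=; last by rewrite leqnn.
  apply: ltr_wpDr; last exact: exprn_gt0.
  by apply: sumr_ge0 => i _; rewrite exprn_ge0 // ltW.
exists x.
  split=> i j ij; first by apply: xlt; rewrite !permKV.
  by rewrite !Delta_of_gaps !permKV ltr_eXn2l.
move=> t /andP[t0 t1].
set z := x + _.
have zE j : z 0 j = (1 - t) * x 0 j + t * y 0 j by rewrite !mxE; ring.
have ord a c a' c' : (pi a < pi c)%N -> (pi a' < pi c')%N ->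
    z 0 a = z 0 c -> z 0 a' = z 0 c' -> a' = a /\ c' = c.
  move=> ac ac' zac zac'.
  pose P := x 0 c - x 0 a; pose P' := x 0 c' - x 0 a'.
  pose q := y 0 c - y 0 a; pose q' := y 0 c' - y 0 a'.
  have P0 : 0 < P by rewrite subr_gt0 xlt.
  have P'0 : 0 < P' by rewrite subr_gt0 xlt.
  have E : (1 - t) * P + t * q = 0 by apply: segment_tie; rewrite -!zE.
  have E' : (1 - t) * P' + t * q' = 0 by apply: segment_tie; rewrite -!zE.
  have u0 : 0 < 1 - t by rewrite subr_gt0.
  have q0 : q != 0.
    by apply/eqP => h; move/eqP: E; rewrite h mulr0 addr0 mulf_eq0 !gt_eqF.
  have q'0 : q' != 0.
    by apply/eqP => h; move/eqP: E'; rewrite h mulr0 addr0 mulf_eq0 !gt_eqF.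
  have /HQ Q0 : root (Q ((a, c), (a', c'))) s.
    have [eP eP'] := (xB a c (ltnW ac), xB a' c' (ltnW ac')).
    rewrite rootE /Q /= hornerD hornerN !hornerZ -eP -eP' -/P -/P' -/q -/q'.
    have : t * (q' * P - q * P') = 0.
      have -> : t * (q' * P - q * P') = P * ((1 - t) * P' + t * q')
         - P' * ((1 - t) * P + t * q) by ring.
      by rewrite E E' !mulr0 subrr.
    by move/eqP; rewrite mulf_eq0 (gt_eqF t0).
  (* The exponents are distinct, so each position has its own coefficient in [Q]. As q and q' are
     nonzero, [Q] vanishes only if the two intervals of positions coincide. *)
  have Ieq k : I a c k = I a' c' k.
    have := congr1 (fun p : {poly R} => p`_(tau k).+1) Q0.
    rewrite /Q coefB !coefZ !coef_pol coef0.
    rewrite -[LHS]/(q' * (I a c k)%:R - q * (I a' c' k)%:R).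
    case: (I a c k); case: (I a' c' k) => //=; rewrite ?mulr1 ?mulr0 ?subr0 ?sub0r.
      by move=> h; rewrite h eqxx in q'0.
    by move/eqP; rewrite oppr_eq0 (negbTE q0).
  (* A nonempty interval determines its ends: it starts at [pi e] and stops at [(pi f).-1]. *)
  have half e f e' f' : (pi e < pi f)%N -> (forall k, I e f k = I e' f' k) ->
      (pi e' <= pi e)%N /\ (pi f <= pi f')%N.
    move=> ef eI.
    have ped : (pi e < d)%N by rewrite (leq_trans ef) // -ltnS.
    have pfd : ((pi f).-1 < d)%N by rewrite -ltnS (ltn_predK ef).
    have : I e f (Ordinal ped) by rewrite /= leqnn ef.
    rewrite eI => /andP[le1 _]; split; first exact: le1.
    have : I e f (Ordinal pfd) by exact: pred_between.
    by rewrite eI => /andP[_]; exact: pred_lt_leq.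
  have [h1 h2] := half _ _ _ _ ac Ieq.
  have [h3 h4] := half _ _ _ _ ac' (fun k => esym (Ieq k)).
  by split; apply: (@perm_inj _ pi); apply/val_inj/eqP; rewrite eqn_leq ?h1 ?h2 ?h3 ?h4.
have tri a c : a != c -> (pi a < pi c)%N \/ (pi c < pi a)%N.
  move=> ac; apply/orP; rewrite -neq_ltn; apply: contra ac => /eqP/val_inj.
  by move/perm_inj ->.
move=> a c a' c' /tri[] ac /tri[] ac' zac zac'.
- by left; apply: ord.
- by right; have [] := ord _ _ _ _ ac ac' zac (esym zac').
- by right; have [] := ord _ _ _ _ ac ac' (esym zac) zac'.
- by left; have [] := ord _ _ _ _ ac ac' (esym zac) (esym zac').
Qed.

End Gaps.

From mathcomp Require Import all_classical all_reals.
From mathcomp Require Import topology normedtype derive.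
Import numFieldNormedType.Exports.
Local Open Scope classical_set_scope.

(** * Maxima over compact pieces and the global argument *)

Lemma continuous_quadratic (R : realType) (a0 a1 a2 : R) :
  continuous (fun t : R => a0 + a1 * t + a2 * (t * t)).
Proof.
move=> t; apply: cvgD.
  by apply: cvgD; [exact: cvg_cst|apply: cvgM; [exact: cvg_cst|exact: cvg_id]].
by apply: cvgM; [exact: cvg_cst|apply: cvgM; exact: cvg_id].
Qed.

Lemma closed_affine_le (R : realType) (a0 a1 c0 c1 : R) :
  closed [set t : R | a0 + a1 * t <= c0 + c1 * t].
Proof.
rewrite (_ : mkset _ = (fun t => (c0 - a0) + (c1 - a1) * t + 0 * (t * t)) @^-1` [set x | 0 <= x]).
  by apply: preimage_closed => [t _|]; [exact: continuous_quadratic|exact: closed_ge].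
apply/seteqP; split=> t /=; rewrite mul0r addr0; lra.
Qed.

(** Maximum of a piecewise function; the pieces need not agree where they overlap. *)
Lemma finite_compact_max (R : realType) (I : finType) (K : I -> set R) (f : I -> R -> R) :
  (forall i, compact (K i)) -> (forall i, continuous (f i)) ->
  (exists i t, K i t) ->
  exists i t, K i t /\ forall j s, K j s -> f j s <= f i t.
Proof.
move=> cK cf [i0 [t0 Kt0]].
suff H (l : seq I) : (forall i t, i \in l -> ~ K i t) \/
    exists i t, [/\ i \in l, K i t & forall j s, j \in l -> K j s -> f j s <= f i t].
  have [no|[i [t [_ Kt mt]]]] := H (enum I).
    by case: (no i0 t0); rewrite ?mem_enum.
  by exists i, t; split=> // j s; apply: mt; rewrite mem_enum.
elim: l => [|i l IH]; first by left.
have [Kne|Ke] := pselect (K i !=set0); last first.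
  have noi t : ~ K i t by move=> Kt; apply: Ke; exists t.
  case: IH => [no|[j [t [jl Kt mt]]]]; [left|right].
    by move=> j t; rewrite inE => /orP[/eqP->|]; [exact: noi|exact: no].
  exists j, t; split=> //; first by rewrite inE jl orbT.
  by move=> k s; rewrite inE => /orP[/eqP-> /noi|]; [|exact: mt].
have [t] := compact_EVT_max Kne (cK i) (continuous_subspaceT (cf i)).
rewrite inE => Kt mt; right.
have mi s : K i s -> f i s <= f i t by move=> Ks; apply: mt; rewrite inE.
case: IH => [no|[j [s [jl Ks ms]]]].
  exists i, t; split=> //; first by rewrite inE eqxx.
  by move=> k r; rewrite inE => /orP[/eqP-> /mi//|kl Kr]; case: (no k r).
have [le|lt] := leP (f j s) (f i t).
  exists i, t; split=> //; first by rewrite inE eqxx.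
  move=> k r; rewrite inE => /orP[/eqP-> /mi//|kl Kr].
  exact: le_trans (ms _ _ kl Kr) le.
exists j, s; split=> //; first by rewrite inE jl orbT.
move=> k r; rewrite inE => /orP[/eqP-> /mi h|]; last exact: ms.
exact: le_trans h (ltW lt).
Qed.

(** The second difference of t + t^2 with step s is 2 s^2, so the perturbation adds delta s^2 > 0 to
    a midpoint inequality: both neighbours cannot stay below the value at t. *)
Lemma strict_midpoint (R : realFieldType) (a a1 a2 e e1 e2 delta t s : R) :
  2 * a <= a1 + a2 -> e1 + e2 = 2 * e -> 0 < delta * (s * s) ->
  a1 - e1 + delta / 2 * (t + s + (t + s) * (t + s)) <= a - e + delta / 2 * (t + t * t) ->
  a2 - e2 + delta / 2 * (t - s + (t - s) * (t - s)) <= a - e + delta / 2 * (t + t * t) ->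
  False.
Proof.
move=> ha he pos h1 h2.
have := lerD h1 h2.
have -> : a1 - e1 + delta / 2 * (t + s + (t + s) * (t + s)) +
  (a2 - e2 + delta / 2 * (t - s + (t - s) * (t - s))) =
  (a1 + a2) - (e1 + e2) + delta * (t + t * t) + delta * (s * s) by field.
have -> : a - e + delta / 2 * (t + t * t) + (a - e + delta / 2 * (t + t * t))
  = 2 * a - 2 * e + delta * (t + t * t) by field.
rewrite he; lra.
Qed.

Section Global.
Variables (R : realType) (d : nat) (b : osp d -> R).
Hypotheses (sub : locally_submodular b) (ess : essential_inequalities b).
Implicit Types (pi : 'S_d.+1) (tau : 'S_d) (x y z u v w : 'rV[R]_d.+1).

Lemma compact_segment_sigma pi tau x u :
  compact [set t : R | 0 <= t <= 1 /\ sigma pi tau (x + t *: u)].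
Proof.
apply: (subclosed_compact _ (@segment_compact R 0 1)); last first.
  by move=> t [t01 _] /=; rewrite in_itv.
pose D i y := Delta pi y i : R.
have -> : [set t : R | 0 <= t <= 1 /\ sigma pi tau (x + t *: u)] =
  [set t : R | 0 <= t] `&` [set t : R | t <= 1] `&`
  ((\bigcap_(p in [set p : 'I_d.+1 * 'I_d.+1 | (p.1 <= p.2)%N])
     [set t : R | x 0 ((pi^-1)%g p.1) + u 0 ((pi^-1)%g p.1) * t
       <= x 0 ((pi^-1)%g p.2) + u 0 ((pi^-1)%g p.2) * t]) `&`
   (\bigcap_(p in [set p : 'I_d * 'I_d | (p.1 <= p.2)%N])
     [set t : R | D ((tau^-1)%g p.1) x + D ((tau^-1)%g p.1) u * t
       <= D ((tau^-1)%g p.2) x + D ((tau^-1)%g p.2) u * t])).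
  apply/seteqP; split=> t.
    move=> [/andP[t0 t1] [h1 h2]]; split; first by split.
    split=> -[i j] /= ij; first by have := h1 i j ij; rewrite !mxE ![t * _]mulrC.
    by have := h2 i j ij; rewrite !DeltaD !DeltaZ ![t * _]mulrC.
  move=> [[t0 t1] [h1 h2]]; split; first exact/andP.
  split=> i j ij; first by have := h1 (i, j) ij; rewrite /= !mxE ![t * _]mulrC.
  by have := h2 (i, j) ij; rewrite /= !DeltaD !DeltaZ ![t * _]mulrC.
apply: closedI; first by apply: closedI; [exact: closed_ge|exact: closed_le].
by apply: closedI; apply: closed_bigI => p _; exact: closed_affine_le.
Qed.

(* Otherwise the difference between the piecewise linear function and its
   linear piece at sigma(pi, tau), made strictly convex by a small quadratic
   term, would have an interior maximum on a segment towards [y]. *)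
Lemma vert_global pi tau y : exists pi' tau',
  sigma pi' tau' y /\ dot y (vert b pi tau) <= dot y (vert b pi' tau').
Proof.
apply: contrapT => no.
pose v0 := vert b pi tau; pose vc (c : 'S_d.+1 * 'S_d) := vert b c.1 c.2.
have neg c : sigma c.1 c.2 y -> 0 < dot y v0 - dot y (vc c).
  move=> sc; rewrite subr_gt0 ltNge; apply/negP => le.
  by apply: no; exists c.1, c.2.
(* With constant direction 1 this yields a [delta] below the defect at [y] of every cone containing
   [y]. *)
have [delta /andP[del0 _] Hdel] := exists_step (fun c => dot y v0 - dot y (vc c))
   (fun=> 1) (@ltr01 R).
have [x intx tiex] := generic_segment pi tau y.
pose u := y - x; pose z t := x + t *: u.
have zE t v : dot (z t) v = dot x v + t * dot u v by rewrite /z dotDl dotZl.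
(* The perturbation is 0 at t = 0 and [delta] at t = 1; the whole is written as a quadratic in [t]
   for the sake of continuity. *)
pose psi c t := (dot x (vc c) - dot x v0) +
  (dot u (vc c) - dot u v0 + delta / 2) * t + (delta / 2) * (t * t).
have psiE c t : psi c t = dot (z t) (vc c) - dot (z t) v0 + delta / 2 * (t + t * t).
  by rewrite !zE /psi; ring.
pose K (c : 'S_d.+1 * 'S_d) := [set t : R | 0 <= t <= 1 /\ sigma c.1 c.2 (z t)].
have [|c [t [[/andP[t0 t1] sc] maxt]]] :=
    @finite_compact_max R _ K psi (fun c => @compact_segment_sigma c.1 c.2 x u)
      (fun c => @continuous_quadratic R _ _ _).
  by exists (pi, tau), 0; split; rewrite ?lexx ?ler01 // /z scale0r addr0; exact: sigma_interiorW.
(* Close to [x] the segment stays in the chamber of [pi], where f is at least the piece of [v0]; the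
   perturbation makes [psi] positive there. *)
have psi_pos : 0 < psi c t.
  have [s /andP[s0 s1] Hs] := exists_step
    (fun p : 'I_d.+1 * 'I_d.+1 => x 0 p.2 - x 0 p.1) (fun p => u 0 p.2 - u 0 p.1) (@ltr01 R).
  have chs : chamber pi (z s).
    move=> i j; rewrite leq_eqVlt => /orP[/eqP/val_inj -> //|ij].
    have [] := Hs ((pi^-1)%g i, (pi^-1)%g j).
      by rewrite /= subr_gt0; apply: (proj1 intx).
    rewrite /= !mxE => h _; rewrite -subr_ge0; apply: ltW; move: h.
    by rewrite mulrBr opprD addrACA.
  have [tau' ss hs] := chamber_vert sub chs.
  have Ks : K (pi, tau') s by split; rewrite ?(ltW s0) ?s1.
  apply: lt_le_trans (maxt _ _ Ks); rewrite psiE ltr_wpDl ?subr_ge0 //; first exact: hs.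
  by rewrite mulr_gt0 ?divr_gt0 // addr_gt0 // mulr_gt0.
(* At [x] the only cone is sigma(pi, tau), where [psi] is 0. *)
have {}t0 : 0 < t.
  rewrite lt_neqAle t0 andbT; apply/eqP => te; move: psi_pos sc; rewrite -te psiE /z.
  rewrite scale0r addr0 mulr0 addr0 mulr0 addr0 => lt /(sigma_interior_uniq intx)[e1 e2].
  by move: lt; rewrite /vc e1 e2 subrr ltxx.
(* At [y] the defect exceeds [delta], so [psi] is negative. *)
have {}t1 : t < 1.
  rewrite lt_neqAle t1 andbT; apply/eqP => te; move: psi_pos sc; rewrite te psiE.
  have -> : z 1 = y by rewrite /z scale1r /u addrC subrK.
  rewrite mulr1 => lt /neg /Hdel[_].
  move: lt; set p := dot _ _; set q := dot _ _ => lt; lra.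
have m0 : 0 < Num.min t (1 - t) by rewrite lt_min t0 subr_gt0.
have tie := tiex t; rewrite t0 t1 in tie.
have [s /andP[s0]] := local_midpoint_convex sub ess u sc (tie isT) m0.
rewrite le_min => /andP[st s1t] [c1 [c2 [h1 h2 h3]]].
have zp : z t + s *: u = z (t + s) by rewrite /z scalerDl addrA.
have zm : z t - s *: u = z (t - s) by rewrite /z scalerBl addrA.
rewrite zp zm in h1 h2 h3.
have K1 : K c1 (t + s).
  split=> //; apply/andP; split; first by apply: addr_ge0; exact: ltW.
  by rewrite -lerBrDl.
have K2 : K c2 (t - s).
  split=> //; rewrite subr_ge0 st /= lerBlDr.
  by apply: ler_wpDr; exact: ltW.
have v0E : dot (z (t + s)) v0 + dot (z (t - s)) v0 = 2 * dot (z t) v0.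
  by rewrite !zE; ring.
have pos : 0 < delta * (s * s) by rewrite !mulr_gt0.
apply: (strict_midpoint h3 v0E pos).
  by have := maxt _ _ K1; rewrite (psiE c1) (psiE c); apply.
by have := maxt _ _ K2; rewrite (psiE c2) (psiE c); apply.
Qed.

End Global.

(** * Normal fans and support functions *)

Section Polyhedra.
Variables (R : realType) (n : nat).
Implicit Types (P : set 'rV[R]_n.+1).

Lemma dot_continuous (a : 'rV[R]_n.+1) : continuous (dot a).
Proof.
apply: (@continuous_big R _ +%R 0 xpredT (@add_continuous R) 'rV[R]_n.+1
  (index_enum 'I_n.+1) (fun i x => a 0 i * x 0 i)).
by move=> i _ x; apply: cvgMl_tmp; [exact: nbhs_filter|exact: (@coord_continuous R 1 n.+1 0 i x)].
Qed.

Lemma finite_polyhedron (I : finType) (a : I -> 'rV[R]_n.+1) (c : I -> R) :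
  is_polyhedron [set x | forall i, dot (a i) x <= c i].
Proof.
exists #|I|, (fun k => a (enum_val k)), (fun k => c (enum_val k)).
apply/seteqP; split=> x /= H i; first exact: H.
by have := H (enum_rank i); rewrite enum_rankK.
Qed.

Lemma polyhedron_closed P : is_polyhedron P -> closed P.
Proof.
move=> [m [a [c ->]]].
have -> : [set x | forall i, dot (a i) x <= c i] =
    \bigcap_(i in [set: 'I_m]) (dot (a i) @^-1` [set t | t <= c i]).
  by apply/seteqP; split=> x /= H i; [move=> _|]; exact: H.
apply: closed_bigI => i _; apply: preimage_closed => [x _|]; last exact: closed_le.
exact: dot_continuous.
Qed.

Lemma polytope_face P w : is_polytope P ->
  exists2 x, P x & forall y, P y -> dot w y <= dot w x.
Proof.
move=> [P0 polyP bP].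
have [x] := EVT_max_rV P0 (bounded_closed_compact bP (polyhedron_closed polyP))
  (continuous_subspaceT (@dot_continuous w)).
by rewrite inE => Px mx; exists x => // y Py; apply: mx; rewrite inE.
Qed.

Lemma dot_bounded_set P :
  (forall w, exists M, forall x, P x -> dot w x <= M) -> bounded_set P.
Proof.
move=> bdd.
have [M HM] := choice bdd.
pose N := \big[Num.max/0]_(j < n.+1) Num.max (M (delta_mx 0 j)) (M (- delta_mx 0 j)).
exists N; split; first exact: num_real.
move=> K NK x Px; apply: le_trans (ltW NK).
rewrite [leLHS]/Num.Def.normr /= mx_normrE; apply: bigmax_le.
  by apply: bigmax_ge_id.
move=> [i j] _ /=; rewrite ord1.
have h1 := HM (delta_mx 0 j) x Px; have h2 := HM (- delta_mx 0 j) x Px.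
rewrite dotNl !dot_delta in h1 h2.
apply: (le_trans _ (le_bigmax 0 (fun j => Num.max (M (delta_mx 0 j)) (M (- delta_mx 0 j))) j)).
by rewrite ler_norml lerNl !le_max h1 h2 orbT.
Qed.

End Polyhedra.

(** [b] is the restriction of the support function of [P] to the vectors e_T. *)
Definition support_values (R : realType) (d : nat) (P : set 'rV[R]_d.+1) (b : osp d -> R) :=
  forall T, (forall x, P x -> dot (e_osp R T) x <= b T) /\
            (exists2 x, P x & dot (e_osp R T) x = b T).

Lemma support_values_uniq (R : realType) (d : nat) (P : set 'rV[R]_d.+1) b b' :
  support_values P b -> support_values P b' -> b = b'.
Proof.
move=> sb sb'; apply/funext => T; apply/le_anti/andP.
have [h [x Px xT]] := sb T; have [h' [x' Px' xT']] := sb' T.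
by split; [rewrite -xT h'|rewrite -xT' h].
Qed.

(** * From conditions (1) and (2) to a generalized nested permutohedron *)

Section System.
Variables (R : realType) (d : nat) (b : osp d -> R).
Implicit Types (pi : 'S_d.+1) (tau : 'S_d) (x y w : 'rV[R]_d.+1) (T : osp d).

Lemma system_le x T : system_solutions b x -> dot (e_osp R T) x <= b T.
Proof.
move=> [x1 xT]; have [->|/xT//] := eqVneq T (osp_top d).
by rewrite e_top x1.
Qed.

Lemma system_polyhedron : is_polyhedron (system_solutions b).
Proof.
(* Every T is some [ospb pi A], so pairs (pi, A) index the inequalities by a finite type; [None]
   carries the reverse half of the equation. *)
pose I : finType := option ('S_d.+1 * {set 'I_d}).
have := @finite_polyhedron R d I
  (fun i => if i is Some (pi, A) then e_osp R (ospb pi A) else - const_mx 1)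
  (fun i => if i is Some (pi, A) then b (ospb pi A) else - b (osp_top d)).
set S := (S in is_polyhedron S -> _); suff -> : S = system_solutions b by [].
apply/seteqP; split=> x; last first.
  move=> xs [[pi A]|]; first exact: system_le.
  by rewrite dotNl (proj1 xs).
move=> /= H.
have HT T : dot (e_osp R T) x <= b T.
  have [pi /in_intervalE /in_interval_ospb[A ->]] := chamber_exists (e_osp R T).
  exact: (H (Some (pi, A))).
split=> // ; apply/le_anti; rewrite -e_top HT /=.
by have := H None; rewrite dotNl lerN2 e_top.
Qed.

Lemma system_le_vert pi tau w x : sigma pi tau w -> system_solutions b x ->
  dot w x <= dot w (vert b pi tau).
Proof.
move=> sw sx; apply: vert_le_sigma => // [|k]; first exact: (proj1 sx).
exact: system_le.
Qed.

Hypotheses (sub : locally_submodular b) (ess : essential_inequalities b).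

Lemma vert_system pi tau : system_solutions b (vert b pi tau).
Proof.
split=> [|T _]; first exact: dot_top_vert.
have [pi' [tau' [[ch srt] le]]] := vert_global sub ess pi tau (e_osp R T).
apply: le_trans le _; apply: vert_le_interval => //.
by apply/(@in_intervalE R).
Qed.

Lemma system_support_values : support_values (system_solutions b) b.
Proof.
move=> T; split=> [x|]; first exact: system_le.
have [pi [tau sT]] := sigma_exists (e_osp R T).
exists (vert b pi tau); first exact: vert_system.
have /in_intervalE /in_interval_ospb[A TA] := proj1 sT.
by rewrite TA in sT *; have [m ->] := sigma_upset sT; rewrite dot_chain_vert.
Qed.

Lemma system_polytope : is_polytope (system_solutions b).
Proof.
split; [by exists (vert b 1%g 1%g); exact: vert_system|exact: system_polyhedron|].
apply: dot_bounded_set => w; have [pi [tau sw]] := sigma_exists w.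
by exists (dot w (vert b pi tau)) => x; exact: system_le_vert.
Qed.

(* In the coordinates of [decomposition], the normal cone of [F] meets
   sigma(pi, tau) where the coefficients of those [e_T] vanish that distinguish
   some point of [F] from [vert b pi tau]. *)
Lemma normal_cone_sigma_face pi tau F w : is_face (system_solutions b) F ->
  sigma pi tau w -> normal_cone (system_solutions b) F w ->
  is_face (sigma pi tau)
    [set w | sigma pi tau w /\ forall x, F x -> dot w x = dot w (vert b pi tau)].
Proof.
move=> [[x0 Fx0] [w0 FE]] sw Cw; set v := vert b pi tau.
have FP x : F x -> system_solutions b x by rewrite FE => -[].
pose e k := e_osp R (ospb pi (upset tau k)).
(* [X k] is a point of [F] where the k-th chain inequality is strict, if there is one, and any point
   of [F] otherwise. *)
have /choice[X HX] (k : 'I_d) : exists z, F z /\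
    (dot (e k) z = dot (e k) v -> forall x, F x -> dot (e k) x = dot (e k) v).
  have [[x Fx ne]|no] := pselect (exists2 x, F x & dot (e k) x <> dot (e k) v).
    by exists x.
  exists x0; split=> // _ x Fx; apply: contrapT => ne; apply: no; by exists x.
(* Each summand is nonpositive on the cone, so the maximum of [u] there is 0, reached exactly where
   all of them vanish. *)
pose u := \sum_k (X k - v).
have uE y : dot u y = \sum_k (dot y (X k) - dot y v).
  by rewrite dot_suml; apply: eq_bigr => k _; rewrite dotBl ![dot _ y]dotC.
have le y k : sigma pi tau y -> dot y (X k) - dot y v <= 0.
  by move=> sy; rewrite subr_le0; apply: system_le_vert => //; apply/FP/(proj1 (HX k)).
have s0 : sigma pi tau 0 by split=> i j _; rewrite /Delta !mxE.
split.
  exists w; split=> // x Fx; apply/le_anti/andP; split.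
    by apply: system_le_vert => //; exact: FP.
  by apply: Cw => //; exact: vert_system.
exists u; apply/seteqP; split=> y /=.
  move=> [sy Hy]; split=> // y' sy'.
  have -> : dot u y = 0.
    by rewrite uE big1 // => k _; rewrite Hy ?subrr //; exact: (proj1 (HX k)).
  by rewrite uE; apply: sumr_le0 => k _; apply: le.
move=> [sy Hy]; split=> // x Fx.
have uy : dot u y = 0.
  apply/le_anti; rewrite {1}uE sumr_le0 => [|k _]; last exact: le.
  by rewrite -(_ : dot u 0 = 0) ?Hy // uE big1 // => k _; rewrite /dot !big1 ?subrr // => i _; rewrite mxE mul0r.
have yk k : dot y (X k) = dot y v.
  apply/eqP; rewrite -subr_eq0 -oppr_eq0.
  have : \sum_k - (dot y (X k) - dot y v) = 0 by rewrite sumrN -uE uy oppr0.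
  move/psumr_eq0P => ->//= l _; by rewrite oppr_ge0 le.
have coefE z : F z -> dot y z - dot y v
    = \sum_l coef pi tau y l * (dot (e l) z - dot (e l) v).
  move=> Fz; rewrite {1 2}(decomposition pi tau y) !dotDl !dotZl.
  rewrite (proj1 (FP _ Fz)) dot_top_vert opprD addrACA subrr add0r !dot_suml -sumrB.
  by apply: eq_bigr => l _; rewrite !dotZl mulrBr.
apply/eqP; rewrite -subr_eq0 coefE // big1 // => k _.
(* The terms are nonpositive with sum zero. A nonzero coefficient at [k] thus forces equality at
   [X k], and then on all of [F]. *)
have /eqP := coefE _ (proj1 (HX k)); rewrite yk subrr eq_sym -oppr_eq0 -sumrN => /eqP.
move/psumr_eq0P => /(_ _ k isT) h.
have : coef pi tau y k * (dot (e k) (X k) - dot (e k) v) = 0.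
  apply/eqP; rewrite -oppr_eq0; apply/eqP; apply: h => l _.
  rewrite oppr_ge0; apply: mulr_ge0_le0; first exact: coef_ge0.
  rewrite subr_le0; apply: system_le_vert; first exact: chain_sigma.
  by apply: FP; exact: (proj1 (HX k)).
move/eqP; rewrite mulf_eq0 => /orP[/eqP->|]; first by rewrite mul0r.
by rewrite subr_eq0 => /eqP /(proj2 (HX k)) -> //; rewrite subrr mulr0.
Qed.

Lemma system_permutohedron : generalized_nested_permutohedron (system_solutions b).
Proof.
split; first exact: system_polytope.
  by exists (b (osp_top d)) => x [<- _]; rewrite dot1.
move=> C [F faceF ->].
(* All fan cones inside the normal cone are taken; [normal_cone_sigma_face] supplies one through
   each of its points. *)
exists [set K | nested_braid_fan K /\ K `<=` normal_cone (system_solutions b) F].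
  by move=> K [].
apply/seteqP; split=> [w Cw|w [K [_ KC] /KC//]].
have [pi [tau sw]] := sigma_exists w.
have [[x0 Fx0] [w0 FE]] := faceF.
exists [set w | sigma pi tau w /\ forall x, F x -> dot w x = dot w (vert b pi tau)].
  split; first by exists pi, tau; apply: normal_cone_sigma_face Cw.
  by move=> y [sy Hy] x z Fx Pz; rewrite (Hy x Fx); apply: system_le_vert.
split=> // x Fx; apply/le_anti/andP; split.
  by apply: system_le_vert => //; move: Fx; rewrite FE => -[].
by apply: Cw => //; exact: vert_system.
Qed.

End System.

(** * From a generalized nested permutohedron to its support values *)

Section Permutohedron.
Variables (R : realType) (d : nat).
Implicit Types (pi : 'S_d.+1) (tau : 'S_d) (x y w : 'rV[R]_d.+1) (T : osp d).

Lemma sigma_interior_step pi tau w x : sigma_interior pi tau w ->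
  exists2 s, 0 < s & sigma pi tau (w - s *: (x - w)).
Proof.
move=> [ch srt].
pose X y (p : ('I_d.+1 * 'I_d.+1) + ('I_d * 'I_d)) : R := match p with
  | inl (i, j) => y 0 ((pi^-1)%g j) - y 0 ((pi^-1)%g i)
  | inr (i, j) => Delta pi y ((tau^-1)%g j) - Delta pi y ((tau^-1)%g i) end.
have [s /andP[s0 _] Hs] := exists_step (X w) (X (x - w)) (@ltr01 R).
exists s => //.
have XE p : X w p - s * X (x - w) p = X (w - s *: (x - w)) p.
  by case: p => -[i j] /=; rewrite /Delta !mxE; ring.
split=> i j; rewrite leq_eqVlt => /orP[/eqP/val_inj -> //|ij].
  have [|_] := Hs (inl (i, j)); first by rewrite /= subr_gt0 ch.
  by rewrite XE /= subr_gt0 => /ltW.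
have [|_] := Hs (inr (i, j)); first by rewrite /= subr_gt0 srt.
by rewrite XE /= subr_gt0 => /ltW.
Qed.

(** From an interior point one can step slightly away from any [x] of the cone. A linear function
    maximal at that point does not increase along the step, so it is maximal at [x] as well. *)
Lemma sigma_face_interior pi tau K w : sigma_interior pi tau w ->
  is_face (sigma pi tau) K -> K w -> K = sigma pi tau.
Proof.
move=> iw [_ [u ->]] [sw wmax]; apply/seteqP; split=> [x []//|x sx].
split=> // y sy; apply: le_trans (wmax y sy) _.
have [s s0 /wmax] := sigma_interior_step x iw.
rewrite dotC dotBl dotZl dotBl ![dot _ u]dotC gerBl.
by rewrite pmulr_rge0 // subr_ge0.
Qed.

Variable P : set 'rV[R]_d.+1.
Hypothesis gnpP : generalized_nested_permutohedron P.

(** The normal cone of the face maximising an interior vector is a union of fan cones. The one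
    containing that vector can only be sigma(pi, tau) itself, so any point of the face is optimal
    for the whole cone. *)
Lemma permutohedron_vertex pi tau : exists2 x, P x &
  forall w y, sigma pi tau w -> P y -> dot w y <= dot w x.
Proof.
have [polyP _ coarse] := gnpP.
(* Only an interior point is wanted here, so the other end of the segment is arbitrary. *)
have [w0 iw0 _] := generic_segment pi tau (0 : 'rV[R]_d.+1).
pose F := [set x | P x /\ forall y, P y -> dot w0 y <= dot w0 x].
have [x0 Px0 mx0] := polytope_face w0 polyP.
have Fx0 : F x0 by [].
have faceF : is_face P F by split; [exists x0|exists w0].
have [D DBr NE] := coarse (normal_cone P F) (ex_intro2 _ _ F faceF erefl).
have : normal_cone P F w0 by move=> x y [_ mx] Py; exact: mx.
rewrite NE => -[K DK Kw0].
have [pi' [tau' faceK]] := DBr K DK.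
have sw0 : sigma pi' tau' w0 by case: faceK => _ [u KE]; move: Kw0; rewrite KE => -[].
have [e1 e2] := sigma_interior_uniq iw0 sw0; rewrite e1 e2 in faceK.
have KE := sigma_face_interior iw0 faceK Kw0.
exists x0 => // w y sw Py.
have : normal_cone P F w by rewrite NE; exists K => //; rewrite KE.
by apply.
Qed.

Lemma permutohedron_support : exists b, support_values P b.
Proof.
have /choice[b Hb] (T : osp d) : exists c : R,
    (forall x, P x -> dot (e_osp R T) x <= c) /\ exists2 x, P x & dot (e_osp R T) x = c.
  have [pi [tau sT]] := sigma_exists (e_osp R T).
  have [x Px mx] := permutohedron_vertex pi tau.
  by exists (dot (e_osp R T) x); split=> [y|]; [exact: mx|exists x].
by exists b.
Qed.

Variable b : osp d -> R.
Hypothesis sb : support_values P b.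

Let sum_const x : P x -> dot (const_mx 1) x = b (osp_top d).
Proof.
move=> Px; have [_ [y Py <-]] := sb (osp_top d).
have [_ [c Hc] _] := gnpP.
by rewrite e_top !dot1 !Hc.
Qed.

Let vertex_value pi tau x T : P x ->
  (forall w y, sigma pi tau w -> P y -> dot w y <= dot w x) ->
  sigma pi tau (e_osp R T) -> dot (e_osp R T) x = b T.
Proof.
move=> Px mx sT; have [h [y Py yT]] := sb T.
by apply/le_anti; rewrite h // -yT mx.
Qed.

(** Comparable partitions have their e-vectors in a common cone, so a single point of [P] attains
    both support values. *)
Let nested_vertex pi (A B : {set 'I_d}) : B \subset A -> exists2 x, P x &
  dot (e_osp R (ospb pi A)) x = b (ospb pi A) /\
  dot (e_osp R (ospb pi B)) x = b (ospb pi B).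
Proof.
move=> /(@nested_sigma R d pi)[tau [sA sB]].
have [x Px mx] := permutohedron_vertex pi tau.
by exists x => //; split; apply: vertex_value mx _.
Qed.

Lemma support_submodular : locally_submodular b.
Proof.
move=> pi S T J M /in_interval_ospb[A ->] /in_interval_ospb[B ->].
move=> /join_ospb -> /meet_ospb ->.
rewrite [leLHS]addrC; have AB := subsetIU A B.
have [x Px [<- <-]] := nested_vertex pi AB.
have [/(_ x Px) hA _] := sb (ospb pi A); have [/(_ x Px) hB _] := sb (ospb pi B).
by apply: le_trans (lerD hA hB); rewrite -!dotDl [X in dot X _]addrC e_ospbIU.
Qed.

Lemma support_essential : essential_inequalities b.
Proof.
move=> T T0 T0' S p q s s' _ ss' vT vT0 vT0' vS.
have [pi /in_intervalE iT] := chamber_exists (e_osp R T).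
have TS := essential_le_top vT vS.
have iS : in_interval pi S.
  apply/in_intervalP => i j ij; move/osp_leP: TS; apply.
  by apply/(iffLR (in_intervalP _ _) iT).
have [A TA] := in_interval_ospb iT; have [B SB] := in_interval_ospb iS.
rewrite TA SB ospb_le in TS.
have [x Px [eT eS]] := nested_vertex pi TS.
rewrite -TA -SB in eT eS.
have [/(_ x Px) h0 _] := sb T0; have [/(_ x Px) h0' _] := sb T0'.
have := congr1 (fun v => dot v x) (essential_e R ss' vT vT0 vT0' vS).
rewrite /= !dotDl !dotZl eT eS sum_const //.
have -> : (p != [::])%:R * b (osp_top d) = if p is [::] then 0 else b (osp_top d).
  by case: (p) => [|? ?]; rewrite ?mul0r ?mul1r.
by move=> <-; rewrite lerD2r; exact: lerD h0 h0'.
Qed.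

Lemma support_system : P = system_solutions b.
Proof.
apply/seteqP; split=> x.
  move=> Px; split; first exact: sum_const.
  by move=> T _; have [h _] := sb T; apply: h.
move=> sx; have [[_ [m [a [c PE]]] _] _ _] := gnpP.
rewrite PE => i /=.
(* The normal of a defining inequality of [P] lies in some cone. The point of [P] optimal for that
   cone attains [b] on its chain, so it bounds [x] in this direction. *)
have [pi [tau si]] := sigma_exists (a i).
have [y Py my] := permutohedron_vertex pi tau.
have : dot (a i) y <= c i by move: Py; rewrite PE; apply.
apply: le_trans; apply: (sigma_le si).
  by rewrite (proj1 sx) sum_const.
move=> k; rewrite (vertex_value Py my); first exact: system_le.
exact: chain_sigma.
Qed.

End Permutohedron.

Theorem theorem4p30 (R : realType) (d : nat) :
  [/\ forall b : osp d -> R,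
        locally_submodular b -> essential_inequalities b ->
        generalized_nested_permutohedron (system_solutions b),
      forall P : set 'rV[R]_d.+1,
        generalized_nested_permutohedron P ->
        exists! b : osp d -> R,
          [/\ locally_submodular b, essential_inequalities b
            & P = system_solutions b]
    & forall (b : osp d -> R) (P : set 'rV[R]_d.+1),
        is_polytope P -> P = system_solutions b -> tight b ->
        (generalized_nested_permutohedron P <->
         locally_submodular b /\ essential_inequalities b)].
Proof.
split.
- exact: system_permutohedron.
- move=> P gP; have [b sb] := permutohedron_support gP.
  exists b; split.
    by split; [apply: support_submodular|apply: support_essential|apply: support_system]; eassumption.
  (* Under (1) and (2) the system is tight everywhere, so [b'] also consists of the support values
     of [P]. *)
  move=> b' [sub ess PE]; apply: support_values_uniq sb _.
  by rewrite PE; exact: system_support_values.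
- move=> b P [[x Px] _ _] PE tb; split=> [gP|[sub ess]]; last first.
    by rewrite PE; exact: system_permutohedron.
  (* Tightness gives attainment below the top; at the top the equation of the system holds at any
     point of [P]. *)
  have sb : support_values P b.
    rewrite PE in Px *; move=> T; split=> [y|]; first exact: system_le.
    have [->|/tb//] := eqVneq T (osp_top d).
    by exists x => //; rewrite e_top (proj1 Px).
  by split; [apply: support_submodular|apply: support_essential]; eassumption.
Qed.
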